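(* Let $\mathcal W$ be an extended Weyl algebra satisfying Condition $(\sigma)$. The map $\mathcal P:S^\mu_{cl}\times S^\nu_{cl}\to S^{\mu+\nu}_{cl}$ and the multiplication maps $$\mathcal W^\mu_k\times\mathcal W^{-\infty}_l\to\mathcal W^{-\infty}_{k+l},\quad \mathcal W^{-\infty}_k\times\mathcal W^\mu_l\to\mathcal W^{-\infty}_{k+l},\quad \mathcal W^\mu_k\times\mathcal W^\nu_l\to\mathcal W^{\mu+\nu}_{k+l},$$ where $\mu,\nu\in\mathbb C$ and $k,l=1,2,\ldots$, are well defined and continuous.
   Context: Symbols. $V\to M$ is a smooth orthogonal vector bundle with an orthogonal connection $\nabla$ over a manifold $M$ (possibly with corners); either $M$ is compact, or $V=TM$ and $M$ has bounded geometry. Put $\langle v\rangle=(1+\|v\|^2)^{1/2}$, $v\in V$. For $m\in\mathbb R$, $S^m_{1,0}=S^m_{1,0}(V)$ is the space of smooth $a:V\to\mathbb C$ such that, for a locally finite cover of $M$ by open sets trivializing $V$ (normal coordinate balls in the bounded geometry case) and a subordinate smooth partition of unity $(\phi_i)$, $|\partial_x^\alpha\partial_\xi^\beta(\phi_i(x)a(x,\xi))|\le C(\alpha,\beta)\langle\xi\rangle^{m-|\beta|}$ for all $i,\alpha,\beta$; the best constants $C(\alpha,\beta)$ define its topology. $S^\infty_{1,0}=\bigcup_m S^m_{1,0}$, $S^{-\infty}=\bigcap_m S^m_{1,0}$. For $\mu\in\mathbb C$, $m=\mathrm{Re}\,\mu$, a symbol $a\in S^m_{1,0}$ is homogeneous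 of order $\mu$ if for some $\rho>0$ one has $a(sv)=s^\mu a(v)$ whenever $s>0$ and $\|v\|,\|sv\|\ge \rho$. $S^\mu_{cl}$ (classical symbols of order $\mu$) is the set of $a\in S^m_{1,0}$ for which there are $a_j\in S^{m-j}_{1,0}$ homogeneous of order $\mu-j$ with $a-\sum_{j<k}a_j\in S^{m-k}_{1,0}$ for all $k$. $S^0_{cl}$ has its usual Fréchet topology (identify it with smooth functions on the closed unit ball bundle, the radial compactification of $V$ via $\xi\mapsto\langle\xi\rangle^{-1}\xi$, with seminorms $\max_{l\le n}\|\nabla^l a\|_\infty$), and $S^\mu_{cl}=\langle\cdot\rangle^\mu S^0_{cl}$ has the corresponding topology. Axioms. An extended Weyl algebra is given by a tuple $(\mathcal W^{-\infty},\mathcal H,V,\mathcal P,q)$ such that: (i) $\mathcal H$ is a Hilbert space, $\mathcal W^{-\infty}=\bigcup_{k\ge1}\mathcal W^{-\infty}_k$ is a strict inductive limit of Fréchet spaces (each $\mathcal W^{-\infty}_k$ closed in $\mathcal W^{-\infty}_{k+1}$ with the subspace topology) and an algebra with $\mathcal W^{-\infty}_k\mathcal W^{-\infty}_l\subset\mathcal W^{-\infty}_{k+l}$ and continuous multiplication $\mathcal W^{-\infty}_k\times\mathcal W^{-\infty}_l\to\mathcal W^{-\infty}_{k+l}$ (an $LF$-algebra), continuously embedded in the bounded operators $\mathcal L(\mathcal H)$, and $T\mapsto T^*$ maps $\mathcal W^{-\infty}$, and each $\mathcal W^{-\infty}_k$, continuously onto itself. (ii) There is an injective $R=R^*\in\mathcal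 W^{-\infty}_1$. (iii) With $\mathcal W^{-\infty}\mathcal H$ the linear span of $\{T\xi\}$, $q:S^\infty_{1,0}\to\mathrm{Hom}(\mathcal W^{-\infty}\mathcal H,\mathcal H)$ is linear, $q(1)=I$, $q(a)$ is symmetric for real $a$, and $q$ restricts to a continuous map $S^{-\infty}\to\mathcal W^{-\infty}_1$. (iv) $q(S^m_{1,0})\mathcal W^{-\infty}_k\subset\mathcal W^{-\infty}_{k+1}$. (v) $\mathcal P:S^\infty_{1,0}\times S^\infty_{1,0}\to S^\infty_{1,0}$ is bilinear; $(a,b)\mapsto q(a)q(b)-q(\mathcal P(a,b))$ is well defined and continuous with values in $\mathcal W^{-\infty}_1$; and the maps $\mathcal P:S^m_{1,0}\times S^n_{1,0}\to S^{m+n}_{1,0}$, $\mathcal P:S^\mu_{cl}\times S^\nu_{cl}\to S^{\mu+\nu}_{cl}$, $(a,b)\mapsto\mathcal P(a,b)-ab:S^m_{1,0}\times S^n_{1,0}\to S^{m+n-1}_{1,0}$ are well defined and continuous. (vi) There are $d>0$ and a continuous seminorm $p$ on $S^{-d-1}_{1,0}$ such that $q(a)$ extends to a bounded operator on $\mathcal H$ with $\|q(a)\|\le p(a)$ for $a\in S^{-d-1}_{1,0}$. (vii) The map $S^m_{1,0}\times\mathcal W^{-\infty}_k\to\mathcal W^{-\infty}_{k+1}$, $(a,T)\mapsto q(a)T$, is continuous. The algebra. $\mathcal W^\mu_k:=q(S^\mu_{cl})+\mathcal W^{-\infty}_k$ with the quotient topology from $S^\mu_{cl}\oplus\mathcal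 W^{-\infty}_k$, $\mathcal W^\mu:=\bigcup_k\mathcal W^\mu_k$ ($\mu\in\mathbb C$). The extended Weyl algebra $\mathcal W$ is the algebraic sum of all $\mathcal W^\mu_k$; it consists of (possibly unbounded) operators with common dense domain $\mathcal W^{-\infty}\mathcal H$. Condition $(\sigma)$: for each order $m$, the map $S^m_{cl}\oplus\mathcal W^{-\infty}\ni(a,T)\mapsto q(a)+T\in\mathcal W^m$ has kernel $\{(a,-q(a)):a\in S^{-\infty}\}$.
   Formalization: The topology of S^0_cl uses the radial compactification ξ ↦ ξ/(1+⟨ξ⟩) instead of ξ/⟨ξ⟩ (under which ⟨ξ⟩^{-1} in S^0_cl is not smooth on the closed ball), with seminorms given by sup-norms of local coordinate derivatives. *)

(* Defs.v *)
From HB Require Import structures.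
From mathcomp Require Import all_boot all_order all_algebra.
From mathcomp Require Import complex.
From mathcomp Require Import all_classical all_reals all_analysis.

Set Implicit Arguments.
Unset Strict Implicit.
Unset Printing Implicit Defensive.

Import Order.TTheory GRing.Theory Num.Theory.
Import numFieldNormedType.Exports.

Local Open Scope classical_set_scope.
Local Open Scope ring_scope.

Section calculus.
Context {R : realType} {n : nat}.
Implicit Types (D : set 'rV[R]_n) (f : 'rV[R]_n -> R).

Definition unitv (k : 'I_n) : 'rV[R]_n := delta_mx 0 k.

Definition diffq (k : 'I_n) f (z : 'rV[R]_n) (t : R) : R :=
  t^-1 * (f (z + t *: unitv k) - f z).

(* [t] tends to 0 through the nonzero reals for which the point stays in [D];
   at a boundary point of a quadrant this is a one-sided limit. *)
Definition incr_filter D (k : 'I_n) (z : 'rV[R]_n) : set_system R :=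
  within [set t | D (z + t *: unitv k)] 0^'.

Definition pder D (k : 'I_n) f (z : 'rV[R]_n) : R :=
  lim (diffq k f z @ incr_filter D k z).

(* A multi-index is encoded by a word in the coordinates. *)
Definition pders D (w : seq 'I_n) f : 'rV[R]_n -> R := foldr (pder D) f w.

Definition smooth_on D f : Prop :=
  forall w : seq 'I_n,
    {within D, continuous (pders D w f)} /\
    forall (k : 'I_n) z, D z -> cvg (diffq k (pders D w f) z @ incr_filter D k z).

Definition csmooth_on D (f : 'rV[R]_n -> R[i]) : Prop :=
  smooth_on D (fun z => complex.Re (f z)) /\
  smooth_on D (fun z => complex.Im (f z)).

Definition cpders D (w : seq 'I_n) (f : 'rV[R]_n -> R[i]) (z : 'rV[R]_n) : R[i] :=
  Complex (pders D w (fun z => complex.Re (f z)) z)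
          (pders D w (fun z => complex.Im (f z)) z).

Definition sqn (x : 'rV[R]_n) : R := \sum_k x 0 k ^+ 2.

Definition quadrant (J : {set 'I_n}) : set 'rV[R]_n :=
  [set x | forall i, i \in J -> 0 <= x 0 i].

Definition quadrant_open D : Prop :=
  exists (J : {set 'I_n}) (O : set 'rV[R]_n), open O /\ D = O `&` quadrant J.

End calculus.

Definition cabs {R : realType} (z : R[i]) : R := complex.Re `|z|.

(* [t] to the complex power [mu], for [t > 0]. *)
Definition cpow {R : realType} (t : R) (mu : R[i]) : R[i] :=
  let th := complex.Im mu * ln t in
  Complex (t `^ complex.Re mu * cos th) (t `^ complex.Re mu * sin th).

(* A coordinate chart of the base on [cdom] together with a trivialization of
   the bundle over [cdom]; the inverse maps are part of the data, and nothing
   is required of any of the four maps outside [cdom] or its image. *)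
Record bchart (R : realType) (n N : nat) (M : topologicalType)
    (V : M -> lmodType R) := BChart {
  cdom : set M;
  cmap : M -> 'rV[R]_n;
  cinv : 'rV[R]_n -> M;
  ctriv : forall x : M, V x -> 'rV[R]_N;
  cfib : forall x : M, 'rV[R]_N -> V x }.

Section charts.
Context {R : realType} {n N : nat} {M : topologicalType} {V : M -> lmodType R}.
Variable ip : forall x, V x -> V x -> R.
Implicit Types c : bchart n N V.

Definition cimg c : set 'rV[R]_n := cmap c @` cdom c.

Record chart_ok c : Prop := ChartOk {
  chart_open : open (cdom c);
  chart_img : quadrant_open (cimg c);
  chart_cont : {within cdom c, continuous (cmap c)};
  chart_cinv : {within cimg c, continuous (cinv c)};
  chart_cancel : forall x, cdom c x -> cinv c (cmap c x) = x;
  chart_lin : forall x, cdom c x -> forall (s : R) (u v : V x),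
    ctriv c (s *: u + v) = s *: ctriv c u + ctriv c v;
  chart_trivK : forall x, cdom c x -> forall v : V x, cfib c x (ctriv c v) = v;
  chart_fibK : forall x, cdom c x -> forall w, ctriv c (cfib c x w) = w;
  chart_isom : forall x, cdom c x -> forall u v : V x,
    ip u v = \sum_k ctriv c u 0 k * ctriv c v 0 k }.

Definition chart_compat c c' : Prop :=
  let D := cmap c @` (cdom c `&` cdom c') in
  (forall k, smooth_on D (fun y => cmap c' (cinv c y) 0 k)) /\
  (forall k l, smooth_on D (fun y =>
     ctriv c' (cfib c (cinv c y) (unitv k)) 0 l)).

End charts.

(* The inner product on the fibres is recorded by the requirement that all the
   trivializations are isometric. *)
Record obundle (R : realType) (n N : nat) := OBundle {
  base : topologicalType;
  fib : base -> lmodType R;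
  vip : forall x, fib x -> fib x -> R;
  atlas : set (bchart n N fib);
  base_hausdorff : hausdorff_space base;
  base_countable : @second_countable base;
  atlas_ok : forall c, atlas c -> chart_ok vip c;
  atlas_cover : forall x, exists2 c, atlas c & cdom c x;
  atlas_compat : forall c c', atlas c -> atlas c' -> chart_compat c c';
  atlas_max : forall c, chart_ok vip c ->
    (forall c', atlas c' -> chart_compat c c' /\ chart_compat c' c) -> atlas c }.

Section bundle.
Context {R : realType} {n N : nat} (B : obundle R n N).
Local Notation M := (base B).
Local Notation chart := (bchart n N (@fib R n N B)).
Implicit Types c : chart.

Definition vtotal : Type := {x : M & fib x}.

Definition vscale (s : R) (v : vtotal) : vtotal :=
  existT _ (projT1 v) (s *: projT2 v).

Definition vnorm (v : vtotal) : R := Num.sqrt (vip (projT2 v) (projT2 v)).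

Definition jap (v : vtotal) : R := Num.sqrt (1 + vnorm v ^+ 2).

Definition cparts c (w : seq 'I_n) (f : M -> R) (x : M) : R :=
  pders (cimg c) w (f \o cinv c) (cmap c x).

Definition cpart c (k : 'I_n) (f : M -> R) (x : M) : R := cparts c [:: k] f x.

Definition bsmooth (f : M -> R) : Prop :=
  forall c, atlas c -> smooth_on (cimg c) (f \o cinv c).

Definition ssmooth (s : forall x : M, fib x) : Prop :=
  forall c, atlas c -> forall l,
    smooth_on (cimg c) (fun y => ctriv c (s (cinv c y)) 0 l).

(* [cov_d c k s x] is the covariant derivative at [x] of the section [s] in the
   direction of the k-th coordinate field of the chart [c]. *)
Record orth_connection := OrthConnection {
  cov_d : chart -> 'I_n -> (forall x : M, fib x) -> forall x : M, fib x;
  cov_dD : forall c k s t x, atlas c -> cdom c x -> ssmooth s -> ssmooth t ->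
    cov_d c k (fun y => s y + t y) x = cov_d c k s x + cov_d c k t x;
  cov_dM : forall c k f s x, atlas c -> cdom c x -> bsmooth f -> ssmooth s ->
    cov_d c k (fun y => f y *: s y) x =
      cpart c k f x *: s x + f x *: cov_d c k s x;
  cov_d_chart : forall c c' k s x, atlas c -> atlas c' -> cdom c x ->
    cdom c' x -> ssmooth s ->
    cov_d c k s x =
      \sum_l cpart c k (fun y => cmap c' y 0 l) x *: cov_d c' l s x;
  cov_d_smooth : forall c k s l, atlas c -> ssmooth s ->
    smooth_on (cimg c) (fun y => ctriv c (cov_d c k s (cinv c y)) 0 l);
  cov_d_orth : forall c k s t x, atlas c -> cdom c x -> ssmooth s -> ssmooth t ->
    cpart c k (fun y => vip (s y) (t y)) x =
      vip (cov_d c k s x) (t x) + vip (s x) (cov_d c k t x) }.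

(* An isomorphism of the bundle with TM: [tco c v] is the vector of components
   of [v] with respect to the coordinate fields of the chart [c]. *)
Record tangent_iso := TangentIso {
  tco : chart -> forall x : M, fib x -> 'rV[R]_n;
  tvec : chart -> forall x : M, 'rV[R]_n -> fib x;
  tco_lin : forall c x, atlas c -> cdom c x -> forall (s : R) (u v : fib x),
    tco c (s *: u + v) = s *: tco c u + tco c v;
  tcoK : forall c x, atlas c -> cdom c x -> forall v : fib x,
    tvec c x (tco c v) = v;
  tvecK : forall c x, atlas c -> cdom c x -> forall w,
    tco c (tvec c x w) = w;
  tco_chart : forall c c' x, atlas c -> atlas c' -> cdom c x -> cdom c' x ->
    forall (v : fib x) l,
    tco c' v 0 l = \sum_k cpart c k (fun y => cmap c' y 0 l) x * tco c v 0 k;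
  tvec_smooth : forall c k l, atlas c ->
    smooth_on (cimg c) (fun y => ctriv c (tvec c (cinv c y) (unitv k)) 0 l) }.

Section riemannian.
Variable t : tangent_iso.

Definition gram c (x : M) : 'M[R]_n :=
  \matrix_(k, l) vip (tvec t c x (unitv k)) (tvec t c x (unitv l)).

Definition christoffel c (m i j : 'I_n) (x : M) : R :=
  2^-1 * \sum_l invmx (gram c x) m l *
    (cpart c i (fun y => gram c y j l) x
     + cpart c j (fun y => gram c y i l) x
     - cpart c l (fun y => gram c y i j) x).

Definition curvature c (m k i j : 'I_n) (x : M) : R :=
  cpart c i (christoffel c m j k) x - cpart c j (christoffel c m i k) x
  + \sum_p (christoffel c m i p x * christoffel c p j k x
            - christoffel c m j p x * christoffel c p i k x).

(* Components of covariant tensors of all ranks, indexed by words. *)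
Definition riem c (w : seq 'I_n) (x : M) : R :=
  if w is [:: l; k; i; j] then \sum_m gram c x l m * curvature c m k i j x
  else 0.

Definition covariant_d c (T : seq 'I_n -> M -> R) (w : seq 'I_n) (x : M) : R :=
  if w is p :: u then
    cpart c p (T u) x
    - \sum_(q < size u) \sum_m
        christoffel c m p (nth p u q) x * T (set_nth p u q m) x
  else 0.

Definition bounded_tensor (r : nat) (T : chart -> seq 'I_n -> M -> R) : Prop :=
  exists K : R, forall c x, atlas c -> cdom c x ->
    forall w : 'I_r -> 'rV[R]_n,
      (forall q, vip (tvec t c x (w q)) (tvec t c x (w q)) <= 1) ->
      `|\sum_(u : r.-tuple 'I_n) T c u x * \prod_(q < r) w q 0 (tnth u q)| <= K.

(* The chart identifies [cdom c] with the ball of radius [r] in such a way that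
   the coordinates are orthonormal at the centre [x0] and the rays from the
   origin are geodesics: [cinv c] is the exponential map at [x0], and it is a
   diffeomorphism on the ball. *)
Definition normal_chart c (x0 : M) (r : R) : Prop :=
  [/\ atlas c,
      cdom c x0 /\ cmap c x0 = 0,
      cimg c = [set y | sqn y < r ^+ 2],
      gram c x0 = 1%:M &
      forall x m, cdom c x ->
        \sum_i \sum_j christoffel c m i j x * cmap c x 0 i * cmap c x 0 j = 0].

(* The orthonormal frame of the trivialization is parallel along these rays. *)
Definition radially_parallel c : Prop :=
  forall x (a : 'I_N) (m : 'I_n), cdom c x ->
    let e l y := tco t c (cfib c y (unitv a)) 0 l in
    \sum_j cmap c x 0 j *
      (cpart c j (e m) x + \sum_l christoffel c m j l x * e l x) = 0.

(* Injectivity radius at least [r0], and bounded derivatives of curvature. *)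
Definition bounded_geometry (r0 : R) : Prop :=
  (forall x0, exists c, normal_chart c x0 r0) /\
  (forall j : nat, bounded_tensor (j + 4) (fun c => iter j (covariant_d c) (riem c))).

End riemannian.

Record symbol_cover := SymbolCover {
  cidx : choiceType;
  cov : cidx -> chart;
  chi : cidx -> M -> R;
  cov_atlas : forall i, atlas (cov i);
  cov_cover : forall x : M, exists i, cdom (cov i) x;
  cov_locfin : forall x : M, exists2 U, nbhs x U &
    finite_set [set i | cdom (cov i) `&` U !=set0];
  chi_smooth : forall i, bsmooth (chi i);
  chi_ge0 : forall i x, 0 <= chi i x;
  chi_supp : forall i, closure [set x | chi i x != 0] `<=` cdom (cov i);
  chi_sum1 : forall x, \sum_(i \in [set: cidx]) chi i x = 1 }.

(* Normal balls of a common radius [r], uniformly locally finite, and a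
   partition of unity with uniformly bounded derivatives. *)
Definition normal_cover (t : tangent_iso) (r : R) (K : symbol_cover) : Prop :=
  [/\ forall i : cidx K, exists x0, normal_chart t (cov i) x0 r,
      forall i : cidx K, radially_parallel t (cov i),
      exists L : nat, forall x (s : seq (cidx K)), uniq s ->
        (forall i, i \in s -> cdom (cov i) x) -> (size s <= L)%N &
      forall w : seq 'I_n, exists b : R, forall (i : cidx K) x,
        cdom (cov i) x -> `|cparts (cov i) w (chi i) x| <= b].

Definition admissible (K : symbol_cover) : Prop :=
  compact [set: M] \/
  exists (t : tangent_iso) (r0 r : R),
    [/\ 0 < r, r < r0, bounded_geometry t r0 & normal_cover t r K].

Local Notation symbol := (vtotal -> R[i]).

Definition local_rep c (a : symbol) (z : 'rV[R]_(n + N)) : R[i] :=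
  a (existT _ (cinv c (lsubmx z)) (cfib c (cinv c (lsubmx z)) (rsubmx z))).

Definition smooth_symbol (a : symbol) : Prop :=
  forall c, atlas c ->
    csmooth_on [set z : 'rV[R]_(n + N) | cimg c (lsubmx z)] (local_rep c a).

Definition xword (w : seq 'I_n) : seq 'I_(n + N) := map (lshift N) w.
Definition fword (w : seq 'I_N) : seq 'I_(n + N) := map (@rshift n N) w.

Section symbol_spaces.
Variable K : symbol_cover.

Definition localize (i : cidx K) (a : symbol) : symbol :=
  fun v => (chi i (projT1 v))%:C%C * a v.

Definition symbol_quot (m : R) (al : seq 'I_n) (be : seq 'I_N) (a : symbol)
    (i : cidx K) (z : 'rV[R]_(n + N)) : R :=
  cabs (cpders [set z | cimg (cov i) (lsubmx z)] (xword al ++ fword be)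
          (local_rep (cov i) (localize i a)) z)
  / Num.sqrt (1 + sqn (rsubmx z)) `^ (m - (size be)%:R).

Definition S10 (m : R) : set symbol := [set a | smooth_symbol a /\
  forall al be, exists b : R, forall i z, cimg (cov i) (lsubmx z) ->
    symbol_quot m al be a i z <= b].

(* The best constant in the estimate with index [(al, be)]. *)
Definition S10_norm (m : R) (ab : seq 'I_n * seq 'I_N) (a : symbol) : \bar R :=
  ereal_sup [set e | exists i z, cimg (cov i) (lsubmx z) /\
                       e = (symbol_quot m ab.1 ab.2 a i z)%:E].

Definition Sinf : set symbol := [set a | exists m, S10 m a].
Definition Sminf : set symbol := [set a | forall m, S10 m a].

Definition homogeneous (mu : R[i]) (a : symbol) : Prop :=
  exists2 rho : R, 0 < rho & forall (s : R) (v : vtotal), 0 < s ->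
    rho <= vnorm v -> rho <= vnorm (vscale s v) ->
    a (vscale s v) = cpow s mu * a v.

Definition Scl (mu : R[i]) : set symbol := [set a |
  let m := complex.Re mu in
  S10 m a /\
  exists a_ : nat -> symbol,
    (forall j : nat, S10 (m - j%:R) (a_ j) /\ homogeneous (mu - j%:R) (a_ j)) /\
    forall k : nat, S10 (m - k%:R) (a - \sum_(j < k) a_ j)].

(* The inverse of the radial compactification [xi |-> xi / (1 + <xi>)], from the
   open unit ball to R^N.  It is the stereographic picture of the map
   [xi |-> (1, xi) / <xi>] to the open half sphere.  With [xi |-> xi / <xi>]
   instead, [<xi>^-1] would extend to the closed ball only as a continuous
   function, [sqrt (1 - |eta|^2)], although it is classical of order 0. *)
Definition unball (eta : 'rV[R]_N) : 'rV[R]_N := (2 / (1 - sqn eta)) *: eta.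

Definition ball_rep (mu : R[i]) (i : cidx K) (a : symbol)
    (z : 'rV[R]_(n + N)) : R[i] :=
  local_rep (cov i) (localize i (fun v => cpow (jap v) (- mu) * a v))
    (row_mx (lsubmx z) (unball (rsubmx z))).

(* Sup-norms of derivatives of [<.>^-mu a] on the unit ball bundle; the open
   ball is dense in the closed one, so the sup may be taken there. *)
Definition Scl_norm (mu : R[i]) (ab : seq 'I_n * seq 'I_N) (a : symbol) : \bar R :=
  ereal_sup [set e | exists i z,
    [/\ cimg (cov i) (lsubmx z), sqn (rsubmx z) < 1 &
     e = (cabs (cpders [set z | cimg (cov i) (lsubmx z) /\ sqn (rsubmx z) < 1]
                  (xword ab.1 ++ fword ab.2) (ball_rep mu i a) z))%:E]].

End symbol_spaces.

End bundle.

(* The subset [S] of [X] with the topology defined by the seminorms [p]. *)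
Definition seminormed {R : realType} {X : zmodType} {I : eqType}
  (S : set X) (p : I -> X -> \bar R) : Type := {x : X | S x}.

Section seminormed_topology.
Context {R : realType} {X : zmodType} {I : eqType}.
Variables (S : set X) (p : I -> X -> \bar R).
Local Notation T := (seminormed S p).

HB.instance Definition _ := gen_eqMixin T.
HB.instance Definition _ := gen_choiceMixin T.

Definition seminormed_open : set_system T := [set U | forall x, U x ->
  exists (F : seq I) (e : R), 0 < e /\
    forall y : T, (forall i, i \in F -> (p i (sval y - sval x)%R < e%:E)%E) -> U y].

Let opT : seminormed_open setT.
Proof. by move=> x _; exists [::], 1; split=> //; exact: ltr01. Qed.

Let opI : setI_closed seminormed_open.
Proof.
move=> A C oA oC x [Ax Cx].
have [F [e [e0 FA]]] := oA x Ax; have [G [d [d0 GC]]] := oC x Cx.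
exists (F ++ G), (Num.min e d); split; first by rewrite lt_min e0.
move=> y H; split.
- apply: FA => i iF; have := H i; rewrite mem_cat iF => /(_ isT) /lt_le_trans.
  by apply; rewrite lee_fin ge_min lexx.
- apply: GC => i iG; have := H i; rewrite mem_cat iG orbT => /(_ isT) /lt_le_trans.
  by apply; rewrite lee_fin ge_min lexx orbT.
Qed.

Let op_bigU (J : Type) (f : J -> set T) :
  (forall j, seminormed_open (f j)) -> seminormed_open (\bigcup_j f j).
Proof.
move=> of_ x [j _ fjx]; have [F [e [e0 Ff]]] := of_ j x fjx.
by exists F, e; split=> // y /Ff; exists j.
Qed.

HB.instance Definition _ := isOpenTopological.Build T opT opI op_bigU.

End seminormed_topology.

(* The image of [f] with the quotient topology. *)
Definition quot_image {T : topologicalType} {Y : Type} (f : T -> Y) : Type :=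
  {y : Y | exists t, f t = y}.

Definition to_image {T : topologicalType} {Y : Type} (f : T -> Y) (t : T) :
  quot_image f := exist _ (f t) (ex_intro _ t erefl).

Section quotient_image_topology.
Context {T : topologicalType} {Y : Type}.
Variable f : T -> Y.
Local Notation Q := (quot_image f).

HB.instance Definition _ := gen_eqMixin Q.
HB.instance Definition _ := gen_choiceMixin Q.

Definition quot_image_open : set_system Q := [set U | open (to_image f @^-1` U)].

Let opT : quot_image_open setT. Proof. exact: openT. Qed.

Let opI : setI_closed quot_image_open.
Proof. by move=> A C oA oC; exact: openI. Qed.

Let op_bigU (J : Type) (g : J -> set Q) :
  (forall j, quot_image_open (g j)) -> quot_image_open (\bigcup_j g j).
Proof.
by move=> og; rewrite /quot_image_open /= preimage_bigcup; apply: bigcup_open => j _; exact: og.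
Qed.

HB.instance Definition _ := isOpenTopological.Build Q opT opI op_bigU.

End quotient_image_topology.

(* [op] restricts to a well defined and continuous map from [A * B] to [C],
   these spaces being mapped into [X], [Y] and [Z] by [iA], [iB] and [iC]. *)
Definition restricts_continuous {A B C : topologicalType} {X Y Z : Type}
    (iA : A -> X) (iB : B -> Y) (iC : C -> Z) (op : X -> Y -> Z) : Prop :=
  exists2 f : A * B -> C,
    (forall a b, iC (f (a, b)) = op (iA a) (iB b)) & continuous f.

(* Completeness refers to the uniform structure of the additive group. *)
Definition frechet {R : realType} (E : tvsType R[i]) : Prop :=
  [/\ hausdorff_space E,
      exists U : nat -> set E, (forall j, nbhs 0 (U j)) /\
        forall V, nbhs 0 V -> exists j, U j `<=` V &
      forall F : set_system E, ProperFilter F ->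
        (forall U, nbhs 0 U ->
           exists2 A, F A & forall x y, A x -> A y -> U (x - y)) ->
        exists x : E, F --> x].

Section symbol_types.
Context {R : realType} {n N : nat} {B : obundle R n N} (K : symbol_cover B).

Definition S10_space (m : R) := seminormed (S10 K m) (S10_norm K m).

Definition Scl_space (mu : R[i]) := seminormed (Scl K mu) (Scl_norm K mu).

Definition Sminf_space := seminormed (Sminf K)
  (fun mab : R * (seq 'I_n * seq 'I_N) => S10_norm K mab.1 mab.2).

End symbol_types.

Record hilbert (R : realType) := Hilbert {
  hsp :> completeNormedModType R[i];
  hip : hsp -> hsp -> R[i];
  hip_linear : forall (s : R[i]) u v w, hip (s *: u + v) w = s * hip u w + hip v w;
  hip_conj : forall u v, hip v u = (hip u v)^*;
  hip_norm : forall u, `|u| ^+ 2 = hip u u }.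

(* The spaces W^{-oo}_k for [0 < k], as spaces of operators; [Wm 0] is unused. *)
Record smoothing_data (R : realType) (H : hilbert R) := SmoothingData {
  Wm : nat -> tvsType R[i];
  wop : forall k, Wm k -> H -> H }.

Section weyl.
Context {R : realType} {n N : nat} {B : obundle R n N} (K : symbol_cover B).
Context {H : hilbert R} (D : smoothing_data H).
Local Notation symbol := (vtotal B -> R[i]).

Definition Wdom : set H := [set u | forall L : set H,
  L 0 -> (forall (s : R[i]) x y, L x -> L y -> L (s *: x + y)) ->
  (forall k (T : Wm D k) x, (0 < k)%N -> L (wop T x)) -> L u].

Definition Wop : Type := {u : H | Wdom u} -> H.

Definition on_dom (T : H -> H) : Wop := fun u => T (sval u).

Definition preserves_dom (A : Wop) : Prop := forall u, Wdom (A u).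

(* Extension by 0 outside the domain; only used at points of the domain. *)
Definition opapp (A : Wop) (v : H) : H :=
  if pselect (Wdom v) is left h then A (exist _ v h) else 0.

Definition opcomp (A A' : Wop) : Wop := fun u => opapp A (A' u).

Definition adjoint (S T : H -> H) : Prop :=
  forall u v, hip (S u) v = hip u (T v).

Definition bounded_op (T : H -> H) : Prop :=
  (forall (s : R[i]) u v, T (s *: u + v) = s *: T u + T v) /\
  exists b : R, forall u, `|T u| <= b%:C%C * `|u|.

Variables (P : symbol -> symbol -> symbol) (q : symbol -> Wop).

(* A (conjugate) linear map on the strict inductive limit W^{-oo} is continuous
   iff its restrictions to all W^{-oo}_k are, so continuity is stated for these. *)
Record extended_weyl : Prop := ExtendedWeyl {
  ew_frechet : forall k, (0 < k)%N -> frechet (Wm D k);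
  ew_bounded : forall k (T : Wm D k), (0 < k)%N -> bounded_op (wop T);
  ew_linear : forall k (s : R[i]) (S T : Wm D k) u, (0 < k)%N ->
    wop (s *: S + T) u = s *: wop S u + wop T u;
  ew_injective : forall k, (0 < k)%N -> injective (@wop R H D k);
  ew_embedding : forall k, (0 < k)%N -> forall e : R, 0 < e ->
    \forall T \near (0 : Wm D k), forall u, `|wop T u| <= e%:C%C * `|u|;
  ew_strict : forall k, (0 < k)%N ->
    exists j : Wm D k -> Wm D k.+1,
      [/\ forall T, wop (j T) = wop T,
          closed (range j) &
          forall U : set (Wm D k),
            open U <-> exists2 O, open O & U = j @^-1` O];
  ew_mul : forall k l, (0 < k)%N -> (0 < l)%N ->
    restricts_continuous (@wop R H D k) (@wop R H D l) (@wop R H D (k + l))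
      (fun S T => S \o T);
  ew_star : forall k, (0 < k)%N -> exists star : Wm D k -> Wm D k,
    [/\ forall T, adjoint (wop T) (wop (star T)), continuous star &
        range star = setT];

  ew_R : exists T : Wm D 1, injective (wop T) /\ adjoint (wop T) (wop T);

  ew_q_op : forall a, Sinf K a -> forall (s : R[i]) u v, Wdom u -> Wdom v ->
    opapp (q a) (s *: u + v) = s *: opapp (q a) u + opapp (q a) v;
  ew_q_linear : forall (s : R[i]) a b, Sinf K a -> Sinf K b ->
    q (s *: a + b) = s *: q a + q b;
  ew_q1 : q (fun=> 1) = on_dom id;
  ew_q_sym : forall a, Sinf K a -> (forall v, complex.Im (a v) = 0) ->
    forall u v, hip (q a u) (sval v) = hip (sval u) (q a v);
  ew_q_minf : exists2 f : Sminf_space K -> Wm D 1,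
    (forall a, on_dom (wop (f a)) = q (sval a)) & continuous f;

  ew_module : forall m a k (T : Wm D k), S10 K m a -> (0 < k)%N ->
    exists T' : Wm D k.+1, forall u, wop T' u = opapp (q a) (wop T u);

  ew_P_Sinf : forall a b, Sinf K a -> Sinf K b -> Sinf K (P a b);
  ew_P_linearl : forall (s : R[i]) a a' b, Sinf K a -> Sinf K a' -> Sinf K b ->
    P (s *: a + a') b = s *: P a b + P a' b;
  ew_P_linearr : forall (s : R[i]) a b b', Sinf K a -> Sinf K b -> Sinf K b' ->
    P a (s *: b + b') = s *: P a b + P a b';
  ew_qP : forall m m', restricts_continuous
    (sval : S10_space K m -> symbol) (sval : S10_space K m' -> symbol)
    (fun T : Wm D 1 => on_dom (wop T))
    (fun a b => opcomp (q a) (q b) - q (P a b));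
  ew_P_S10 : forall m m', restricts_continuous
    (sval : S10_space K m -> symbol) (sval : S10_space K m' -> symbol)
    (sval : S10_space K (m + m') -> symbol) P;
  ew_P_Scl : forall mu nu, restricts_continuous
    (sval : Scl_space K mu -> symbol) (sval : Scl_space K nu -> symbol)
    (sval : Scl_space K (mu + nu) -> symbol) P;
  ew_P_lead : forall m m', restricts_continuous
    (sval : S10_space K m -> symbol) (sval : S10_space K m' -> symbol)
    (sval : S10_space K (m + m' - 1) -> symbol) (fun a b => P a b - a * b);

  ew_q_bounded : exists (d : R) (p : symbol -> R),
    [/\ 0 < d,
        [/\ forall a, S10 K (- d - 1) a -> 0 <= p a,
            forall (s : R[i]) a, S10 K (- d - 1) a -> p (s *: a) = cabs s * p a &
            forall a b, S10 K (- d - 1) a -> S10 K (- d - 1) b ->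
              p (a + b) <= p a + p b],
        continuous (fun a : S10_space K (- d - 1) => p (sval a)) &
        forall a, S10 K (- d - 1) a -> exists T : H -> H,
          [/\ bounded_op T, on_dom T = q a &
              forall u, `|T u| <= (p a)%:C%C * `|u|]];

  ew_module_cont : forall m k, (0 < k)%N -> restricts_continuous
    (sval : S10_space K m -> symbol) (@wop R H D k) (@wop R H D k.+1)
    (fun a T u => opapp (q a) (T u)) }.

Definition Wmu_space (mu : R[i]) (k : nat) := quot_image
  (fun aT : Scl_space K mu * Wm D k => q (sval aT.1) + on_dom (wop aT.2)).

Definition condition_sigma : Prop :=
  forall (m : R) a k (T : Wm D k), Scl K m%:C%C a -> (0 < k)%N ->
    q a + on_dom (wop T) = 0 <->
    Sminf K a /\ on_dom (wop T) = - q a.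

End weyl.

(* Main.v *)
(* The product expands as
     (q(a) + S)(q(b) + T) = q(P(a,b)) + E(a,b) + q(a) T + S q(b) + S T,
   where E(a,b) = q(a) q(b) - q(P(a,b)) is smoothing and S q(b) is the adjoint of
   q(conj b) S^*, so that every term depends continuously on ((a,S),(b,T)).  The
   quotient maps onto the spaces W^mu_k are open, because their fibres are cosets and
   translations are homeomorphisms; hence continuity descends to the quotients.

   The axioms on q concern the topologies of S^m_{1,0}, so one needs that the
   inclusion of S^mu_cl in S^{Re mu}_{1,0} is continuous.  In a chart,
     a(x,xi) = <xi>^mu g(x, xi / (1 + <xi>)),
   where g is the representative of <.>^-mu a on the unit ball.  By the chain rule a
   derivative of a of order beta in the fibre variables is a sum of products of
   derivatives of g with symbols of order Re mu - |beta|. *)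
Require Import Defs.
From HB Require Import structures.
From mathcomp Require Import all_boot all_order all_algebra.
From mathcomp Require Import complex.
From mathcomp Require Import all_classical all_reals all_analysis.
From mathcomp Require Import ring lra.

Set Implicit Arguments.
Unset Strict Implicit.
Unset Printing Implicit Defensive.

Import Order.TTheory GRing.Theory Num.Theory.
Import numFieldNormedType.Exports.

Local Open Scope classical_set_scope.
Local Open Scope ring_scope.

(** * Smooth functions generated by an algebra of expressions *)

(** The base may have corners, so derivatives in base directions are limits along admissible
    increments only. The map to the ball is the identity on the base, hence the chain rule is needed
    only in fibre directions. There the domain is open, and continuous partial derivatives give
    total differentiability. Two facts keep the symbol order and make the estimate one between
    seminorms: the derivatives of g enter linearly, and each fibre derivative that falls on g brings
    a factor of order -1, a derivative of xi / (1 + <xi>). The constants must not depend on the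
    chart, because the seminorms are suprema over a cover that may be infinite. On the operator
    side, S q(b) makes sense on the domain only. A smoothing operator is determined by its
    restriction to the domain, because the domain contains the range of the injective self-adjoint
    R; this is what makes the smoothing products well defined. A product of q with a smoothing
    operator raises the level by one, and k, l >= 1 leaves room for this in level k + l. *)

(* Derivatives are computed on syntax, so that the expression obtained for a given
   derivative, hence every constant in its estimate, is the same in all charts. *)
Inductive expr (R G : Type) : Type :=
| Cst of R
| Gen of G
| Add of expr R G & expr R G
| Mul of expr R G & expr R G.
Arguments Cst {R G}.
Arguments Gen {R G}.

Definition esum (R : nzRingType) (G I : Type) (s : seq I) (F : I -> expr R G) :=
  foldr (fun i e => Add (F i) e) (Cst 0) s.

Section expressions.
Context {R : realType} {d : nat} {G : Type}.
Variables (gen : G -> 'rV[R]_d -> R) (dgen : 'I_d -> G -> expr R G).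
Implicit Types (e : expr R G) (D : set 'rV[R]_d).

Fixpoint eval e (z : 'rV[R]_d) : R := match e with
  | Cst c => c
  | Gen g => gen g z
  | Add e1 e2 => eval e1 z + eval e2 z
  | Mul e1 e2 => eval e1 z * eval e2 z
  end.

Fixpoint der (k : 'I_d) e : expr R G := match e with
  | Cst _ => Cst 0
  | Gen g => dgen k g
  | Add e1 e2 => Add (der k e1) (der k e2)
  | Mul e1 e2 => Add (Mul (der k e1) e2) (Mul e1 (der k e2))
  end.

Definition ders (w : seq 'I_d) e := foldr der e w.

Lemma eval_esum (I : Type) (s : seq I) F z :
  eval (esum s F) z = \sum_(i <- s) eval (F i) z.
Proof. by elim: s => [|i s IH] /=; rewrite ?big_nil// big_cons IH. Qed.

(** Makes the limit in [pder] unique, so that any limit found for a difference quotient is the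
    partial derivative. *)
Definition proper_increments D := forall k z, D z -> ProperFilter (incr_filter D k z).

Lemma incr_filterW D k z (Q : set R) :
  (forall t, t != 0 -> D (z + t *: unitv k) -> Q t) -> incr_filter D k z Q.
Proof.
by move=> H; apply: (@filterE _ (nbhs (0 : R))) => t t0 Dt; exact: H.
Qed.

Lemma cvg_incr_eq D k z (f g : R -> R) (l : R) :
  (forall t, t != 0 -> D (z + t *: unitv k) -> f t = g t) ->
  f @ incr_filter D k z --> l -> g @ incr_filter D k z --> l.
Proof.
by move=> fg; apply: cvg_trans; apply: near_eq_cvg; exact: incr_filterW.
Qed.

Lemma diffqM k (f g : 'rV[R]_d -> R) D z (l m : R) : proper_increments D -> D z ->
  diffq k f z @ incr_filter D k z --> l -> diffq k g z @ incr_filter D k z --> m ->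
  diffq k (fun y => f y * g y) z @ incr_filter D k z --> l * g z + f z * m.
Proof.
move=> hD Dz fl gm; have PF := hD k _ Dz.
have t0 : (fun t : R => t) @ incr_filter D k z --> (0 : R).
  by move=> Q Q0; apply: cvg_within; exact: cvg_within.
(* The value of [g] at the moved point is written as [g z + t * diffq k g z t]; its limit [g z] then
   comes from the difference quotient itself. *)
have : (fun t => diffq k f z t * (g z + t * diffq k g z t) + f z * diffq k g z t)
    @ incr_filter D k z --> l * (g z + 0 * m) + f z * m.
  apply: cvgD; apply: cvgM => //; last exact: cvg_cst.
  by apply: cvgD; [exact: cvg_cst|exact: cvgM].
rewrite mul0r addr0; apply: cvg_incr_eq => t t0' _.
rewrite /diffq mulVKf//; ring.
Qed.

Section smoothness.
Variable D : set 'rV[R]_d.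
Hypothesis hD : proper_increments D.
Hypothesis gen_cont : forall g, {within D, continuous (gen g)}.
Hypothesis gen_diffq : forall k g z, D z ->
  diffq k (gen g) z @ incr_filter D k z --> eval (dgen k g) z.

Lemma eval_continuous e : {within D, continuous (eval e)}.
Proof.
elim: e => [c|g|e1 IH1 e2 IH2|e1 IH1 e2 IH2] x.
- exact: cvg_cst.
- exact: gen_cont.
- by apply: cvgD; [exact: IH1|exact: IH2].
- by apply: cvgM; [exact: IH1|exact: IH2].
Qed.

Lemma eval_diffq k e z : D z ->
  diffq k (eval e) z @ incr_filter D k z --> eval (der k e) z.
Proof.
move=> Dz; have PF := hD k Dz.
elim: e => [c|g|e1 IH1 e2 IH2|e1 IH1 e2 IH2] /=.
- apply: (@cvg_incr_eq _ _ _ (cst 0)); last exact: cvg_cst.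
  by move=> t _ _; rewrite /diffq subrr mulr0.
- exact: gen_diffq.
- apply: (cvg_incr_eq _ (cvgD IH1 IH2)) => t _ _.
  by rewrite fctE /diffq /=; ring.
- exact: diffqM.
Qed.

Lemma diffq_eqon k f e z : D z -> (forall y, D y -> f y = eval e y) ->
  diffq k f z @ incr_filter D k z --> eval (der k e) z.
Proof.
move=> Dz fe; apply: (cvg_incr_eq _ (@eval_diffq k e z Dz)) => t _ Dt.
by rewrite /diffq !fe.
Qed.

(** [incr_filter] sees only increments that stay in [D], so an identity valid on [D] alone can be
    differentiated repeatedly. *)
Lemma pders_eval f e w : (forall y, D y -> f y = eval e y) ->
  forall z, D z -> pders D w f z = eval (ders w e) z.
Proof.
move=> fe; elim: w => [|k w IH] z Dz //=; first exact: fe.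
have PF := hD k Dz; rewrite /pder; apply/cvg_lim => //.
exact: diffq_eqon.
Qed.

Lemma smooth_on_eval f e : (forall y, D y -> f y = eval e y) -> smooth_on D f.
Proof.
move=> fe w; have := pders_eval w fe; move: (pders D w f) => h he; split.
  apply: (@subspace_eq_continuous _ _ _ (eval (ders w e))); last exact: eval_continuous.
  by move=> z; rewrite inE => Dz; exact/esym/he.
by move=> k z Dz; apply/cvg_ex; exists (eval (der k (ders w e)) z); exact: diffq_eqon.
Qed.

End smoothness.
End expressions.

Section words.
Context {R : realType} {d : nat} {I : Type}.
Variables (D : set 'rV[R]_d) (f : I -> 'rV[R]_d -> R).

(** Formal differential polynomials in a family of smooth functions: a generator records a function
    with the word of derivatives already taken, and differentiating it prepends a letter. *)
Definition wgen (iw : I * seq 'I_d) := pders D iw.2 (f iw.1).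
Definition dwgen (k : 'I_d) (iw : I * seq 'I_d) : expr R (I * seq 'I_d) :=
  Gen (iw.1, k :: iw.2).

Hypothesis hD : proper_increments D.
Hypothesis fs : forall i, smooth_on D (f i).

Lemma wgen_cont g : {within D, continuous (wgen g)}.
Proof. by case: g => i w; exact: (fs i w).1. Qed.

Lemma wgen_diffq k g z : D z ->
  diffq k (wgen g) z @ incr_filter D k z --> eval wgen (dwgen k g) z.
Proof. by case: g => i w Dz; exact: ((fs i w).2 k z Dz). Qed.

Definition smooth_on_wexpr := smooth_on_eval hD wgen_cont wgen_diffq.
Definition pders_wexpr := pders_eval hD wgen_diffq.

End words.

Section smooth_on_closure.
Context {R : realType} {d : nat} (D : set 'rV[R]_d).
Hypothesis hD : proper_increments D.
Implicit Types f g : 'rV[R]_d -> R.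

Let two f g (b : bool) := if b then f else g.

Let two_smooth f g : smooth_on D f -> smooth_on D g -> forall b, smooth_on D (two f g b).
Proof. by move=> ? ? []. Qed.

Lemma smooth_onM f g : smooth_on D f -> smooth_on D g -> smooth_on D (fun z => f z * g z).
Proof.
move=> fs gs.
by apply: (@smooth_on_wexpr _ _ _ _ (two f g) hD (two_smooth fs gs) _
  (Mul (Gen (true, [::])) (Gen (false, [::])))).
Qed.

Lemma smooth_on_lin s f g : smooth_on D f -> smooth_on D g ->
  smooth_on D (fun z => s * f z + g z).
Proof.
move=> fs gs.
by apply: (@smooth_on_wexpr _ _ _ _ (two f g) hD (two_smooth fs gs) _
  (Add (Mul (Cst s) (Gen (true, [::]))) (Gen (false, [::])))).
Qed.

Lemma pders_lin s f g w z : smooth_on D f -> smooth_on D g -> D z ->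
  pders D w (fun z => s * f z + g z) z = s * pders D w f z + pders D w g z.
Proof.
move=> fs gs Dz.
elim: w z Dz => [|k w IH] z Dz //=.
have PF := hD k Dz; rewrite {1}/pder; apply/cvg_lim => //.
have H : forall y, D y -> pders D w (fun z => s * f z + g z) y = eval (wgen D (two f g))
  (Add (Mul (Cst s) (Gen (true, w))) (Gen (false, w))) y by exact: IH.
have := diffq_eqon hD (wgen_diffq (two_smooth fs gs)) (k := k) Dz H.
by rewrite /= mul0r add0r.
Qed.

End smooth_on_closure.

(** * Continuously differentiable functions and the chain rule *)

Section rows.
Context {R : realType} {d : nat}.

Lemma cvg_row (T : Type) (F : set_system T) {FF : Filter F} (h : T -> 'rV[R]_d) (M : 'rV[R]_d) :
  (forall j, (fun t => h t 0 j) @ F --> M 0 j) -> h @ F --> M.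
Proof.
move=> H; apply/cvg_ballP => e e0.
have : \forall t \near F, forall j, ball (M 0 j) e (h t 0 j).
  by apply: filter_forall => j; have /cvg_ballP/(_ e e0) := H j.
apply: filterS => t Ht; split=> // i j; rewrite ord1; exact: Ht.
Qed.

Lemma near0_row (Q : set 'rV[R]_d) (M : 'rV[R]_d) : nbhs M Q ->
  exists2 e : R, 0 < e & forall h : 'rV[R]_d, (forall j, `|h 0 j| < e) -> Q (M + h).
Proof.
move=> /nbhs_ballP[e /= e0 H]; exists e => // h hh; apply: H; split=> // i j.
by rewrite ord1 /ball /= mxE opprD addNKr normrN.
Qed.

Lemma near_row_forall (I : finType) (f : I -> set 'rV[R]_d) (M : 'rV[R]_d) :
  (forall i, nbhs M (f i)) -> nbhs M [set x | forall i, f i x].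
Proof. by move=> H; apply: (@filter_forall _ I f (nbhs M) (nbhs_filter M)). Qed.

End rows.

Lemma cvg_dnbhs_eq (R : realType) (f g : R -> R) (l : R) :
  (forall t, t != 0 -> f t = g t) ->
  f @ (0 : R)^' --> l -> g @ (0 : R)^' --> l.
Proof.
move=> fg; apply: cvg_trans; apply: near_eq_cvg.
by apply: (@filterE _ (nbhs (0 : R))) => t t0; exact: fg.
Qed.

Lemma cvg_sumr (R : realType) (I : finType) (f : I -> R -> R) (l : I -> R)
    (F : set_system R) : Filter F ->
  (forall i, f i @ F --> l i) -> (fun t => \sum_i f i t) @ F --> \sum_i l i.
Proof.
move=> FF fl; elim: (index_enum I) => [|i s IH].
  rewrite big_nil; have -> : (fun t : R => \sum_(i <- [::]) f i t) = cst 0.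
    by apply/funext => t; rewrite big_nil.
  exact: cvg_cst.
have -> : (fun t : R => \sum_(j <- i :: s) f j t) = f i + (fun t => \sum_(j <- s) f j t).
  by apply/funext => t; rewrite big_cons.
by rewrite big_cons; apply: cvgD; [exact: fl|exact: IH].
Qed.

Section differentiability.
Context {R : realType} {N : nat}.
Variables (G : 'rV[R]_N -> R) (dG : 'I_N -> 'rV[R]_N -> R) (O : set 'rV[R]_N).
Hypothesis Oopen : open O.
Hypothesis dGP : forall j y, O y -> diffq j G y @ (0 : R)^' --> dG j y.

Lemma is_derive_line (p : 'rV[R]_N) j (s : R) : O (p + s *: unitv j) ->
  is_derive s 1 (fun t : R => G (p + t *: unitv j)) (dG j (p + s *: unitv j)).
Proof.
move=> Os; have H := @dGP j _ Os.
suff E : (fun h : R => h^-1 *: (((fun t : R => G (p + t *: unitv j)) \o shift s) (h *: (1 : R)) -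
    G (p + s *: unitv j))) = diffq j G (p + s *: unitv j).
  split.
    by rewrite /derivable; apply/cvg_ex; exists (dG j (p + s *: unitv j)); rewrite E.
  by rewrite /derive E; apply/cvg_lim.
apply/funext => h; rewrite /diffq /=; congr (_ * (G _ - _)).
by rewrite /shift /= -[h *: 1]/(h * 1) mulr1 scalerDl addrAC addrA.
Qed.

Lemma mvt_line (p : 'rV[R]_N) j (s : R) :
  (forall t, `|t| <= `|s| -> O (p + t *: unitv j)) ->
  exists2 t, `|t| <= `|s| &
    G (p + s *: unitv j) - G p = s * dG j (p + t *: unitv j).
Proof.
move=> HO.
(* To be used for the segment from 0 to [s] or from [s] to 0, according to the sign of [s]. *)
have D (a b : R) : a <= b -> (forall t, t \in `[a, b]%R -> `|t| <= `|s|) ->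
   exists2 c, c \in `[a, b]%R & G (p + b *: unitv j) - G (p + a *: unitv j) =
     dG j (p + c *: unitv j) * (b - a).
  move=> ab Hab.
  have Hd x : x \in `[a, b]%R ->
      is_derive x 1 (fun t : R => G (p + t *: unitv j)) (dG j (p + x *: unitv j)).
    by move=> /Hab/HO/is_derive_line.
  pose g (t : R) := G (p + t *: unitv j); pose dg (t : R) := dG j (p + t *: unitv j).
  have H1 x : x \in `]a, b[%R -> is_derive x 1 g (dg x).
    by move=> xab; apply: Hd; apply: subset_itv_oo_cc xab.
  have H2 : {within `[a, b], continuous g}.
    apply: continuous_in_subspaceT => x; rewrite inE => /Hd [Hx _].
    exact/differentiable_continuous/derivable1_diffP.
  have [c cab E] := MVT_segment ab H1 H2.
  by exists c.
have [s0|s0] := leP 0 s.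
  have [|c cab E] := D 0 s s0.
    by move=> t; rewrite in_itv /= => /andP[t0 ts]; rewrite !ger0_norm.
  exists c; last by rewrite mulrC -[s in RHS]subr0 -E scale0r addr0.
  by move: cab; rewrite in_itv /= => /andP[t0 ts]; rewrite !ger0_norm.
have [|c cab E] := D s 0 (ltW s0).
  by move=> t; rewrite in_itv /= => /andP[t0 ts]; rewrite !ler0_norm ?lerN2// ltW.
exists c; first by move: cab; rewrite in_itv /= => /andP[t0 ts]; rewrite !ler0_norm ?lerN2// ltW.
by apply: oppr_inj; rewrite opprB -[p in G p]addr0 -(scale0r (unitv j)) E sub0r mulrN mulrC.
Qed.

(** The points [y] and [y + h] are joined by a path that changes one coordinate at a time. The mean
    value theorem on each edge yields a partial derivative at a point near [y], which by continuity
    differs from the one at [y] by at most [e]. *)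
Lemma partials_differentiable (y : 'rV[R]_N) : O y -> (forall j, dG j @ y --> dG j y) ->
  forall e : R, 0 < e -> exists2 r : R, 0 < r &
    forall h : 'rV[R]_N, (forall j, `|h 0 j| < r) ->
    `|G (y + h) - G y - \sum_j h 0 j * dG j y| <= e * \sum_j `|h 0 j|.
Proof.
move=> Oy dGc e e0.
have : \forall x \near y, O x /\ forall j, `|dG j y - dG j x| <= e.
  have ON := open_nbhs_nbhs (conj Oopen Oy).
  have dN : \forall x \near y, forall j, `|dG j y - dG j x| <= e.
    apply: (near_row_forall (f := fun j x => `|dG j y - dG j x| <= e)) => j.
    by have /cvgrPdist_le/(_ e e0) := dGc j.
  near=> x; split; near: x; [exact: ON|exact: dN].
move=> /near0_row[r r0 Hr]; exists r => // h hr.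
(* [p m] is the corner of the path at which the first [m] coordinates of [h] have been added. *)
pose p (m : nat) := y + \row_i (if (i < m)%N then h 0 i else 0).
have p0 : p 0%N = y.
  by rewrite /p; apply/rowP => i; rewrite !mxE addr0.
have pN : p N = y + h.
  by rewrite /p; congr (_ + _); apply/rowP => i; rewrite !mxE ltn_ord.
have pS (j : 'I_N) : p j.+1 = p j + h 0 j *: unitv j.
  rewrite /p -addrA; congr (_ + _); apply/rowP => i; rewrite !mxE eqxx /=.
  rewrite ltnS; case: (ltngtP i j) => [ij|ij|/ord_inj ->].
  - by rewrite -val_eqE /= ltn_eqF// mulr0 addr0.
  - by rewrite -val_eqE /= gtn_eqF// mulr0 addr0.
  - by rewrite eqxx mulr1 add0r.
rewrite -pN -{1}p0 -(telescope_sumr (G \o p) (leq0n N)) /= big_mkord -sumrB mulr_sumr.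
apply: (le_trans (ler_norm_sum _ _ _)); apply: ler_sum => j _.
have Hp t : `|t| <= `|h 0 j| -> O (p j + t *: unitv j) /\
    forall j', `|dG j' y - dG j' (p j + t *: unitv j)| <= e.
  move=> tj; rewrite /p -addrA; apply: Hr => i; rewrite !mxE eqxx /=.
  case: (ltngtP i j) => [ij|ij|/ord_inj ->].
  - by rewrite -val_eqE /= ltn_eqF// mulr0 addr0.
  - by rewrite -val_eqE /= gtn_eqF// mulr0 addr0 normr0.
  - by rewrite eqxx mulr1 add0r; exact: le_lt_trans (hr j).
have [|t tj E] := @mvt_line (p j) j (h 0 j); first by move=> t /Hp[].
rewrite pS E -mulrBr normrM mulrC; apply: ler_wpM2r => //.
by rewrite distrC; have [_] := Hp t tj; exact.
Unshelve. all: by end_near. Qed.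

Lemma diffq_chain (c : R -> 'rV[R]_N) (v : 'I_N -> R) :
  O (c 0) -> (forall j, dG j @ c 0 --> dG j (c 0)) ->
  (forall j, (fun t : R => t^-1 * (c t 0 j - c 0 0 j)) @ (0 : R)^' --> v j) ->
  (fun t : R => t^-1 * (G (c t) - G (c 0))) @ (0 : R)^' --> \sum_j v j * dG j (c 0).
Proof.
move=> Oc dGc cv.
have Dc : forall e : R, 0 < e -> exists2 r : R, 0 < r &
    forall h : 'rV[R]_N, (forall j, `|h 0 j| < r) ->
    `|G (c 0 + h) - G (c 0) - \sum_j h 0 j * dG j (c 0)| <= e * \sum_j `|h 0 j|.
  exact: partials_differentiable.
have cc j : (fun t : R => c t 0 j - c 0 0 j) @ (0 : R)^' --> (0 : R).
  have t0 : (fun t : R => t) @ (0 : R)^' --> (0 : R) by exact: cvg_within.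
  have H : (fun t : R => t * (t^-1 * (c t 0 j - c 0 0 j))) @ (0 : R)^' --> 0 * v j.
    by apply: cvgM; [exact: t0|exact: cv].
  by rewrite mul0r in H; apply: (cvg_dnbhs_eq _ H) => t t0'; rewrite mulVKf.
have Sc : (fun t : R => \sum_j (t^-1 * (c t 0 j - c 0 0 j)) * dG j (c 0)) @ (0 : R)^' -->
    \sum_j v j * dG j (c 0).
  by apply: cvg_sumr => j; apply: cvgM; [exact: cv|exact: cvg_cst].
apply: cvg_sub0 Sc.
have Nc : (fun t : R => \sum_j `|t^-1 * (c t 0 j - c 0 0 j)|) @ (0 : R)^' --> \sum_j `|v j|.
  by apply: cvg_sumr => j; apply: cvg_norm; exact: cv.
set L := \sum_j `|v j| in Nc.
have L0 : 0 <= L by apply: sumr_ge0.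
have Nb : \forall t \near (0 : R)^', \sum_j `|t^-1 * (c t 0 j - c 0 0 j)| <= L + 1.
  have /cvgrPdist_le/(_ 1 ltr01) := Nc; apply: filterS => t.
  by rewrite distrC ler_norml => /andP[_]; rewrite lerBlDl.
apply/cvgrPdist_le => e e0.
(* The difference quotients of [c] eventually have l1 norm at most [L + 1], so this tolerance gives
   a total error of at most [e]. Adding 1 also keeps the denominator positive when [L] is 0. *)
have [r r0 Hr] := Dc (e / (L + 1)) (divr_gt0 e0 (ltr_wpDl L0 ltr01)).
have Hs : \forall t \near (0 : R)^', forall j, `|c t 0 j - c 0 0 j| < r.
  apply: filter_forall => j; have /cvgrPdist_lt/(_ r r0) := cc j.
  by apply: filterS => t; rewrite sub0r normrN.
apply: filterS2 Nb Hs => t Nt Ht.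
have := Hr (c t - c 0) => /(_ _)/wrap[j|]; first by rewrite !mxE.
rewrite subrKC => E; rewrite sub0r normrN fctE.
have -> : t^-1 * (G (c t) - G (c 0)) - \sum_j t^-1 * (c t 0 j - c 0 0 j) * dG j (c 0) =
  t^-1 * (G (c t) - G (c 0) - \sum_j (c t - c 0) 0 j * dG j (c 0)).
  rewrite [RHS]mulrBr mulr_sumr; congr (_ - _); apply: eq_bigr => j _.
  by rewrite !mxE mulrA.
rewrite normrM; apply: (@le_trans _ _ (`|t^-1| * (e / (L + 1) * \sum_j `|(c t - c 0) 0 j|))).
  by apply: ler_wpM2l.
rewrite mulrCA mulr_sumr -[leRHS](@divfK _ (L + 1)) ?gt_eqF ?ltr_wpDl//.
apply: ler_wpM2l; first by rewrite divr_ge0 ?addr_ge0// ltW.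
apply: le_trans Nt; apply: ler_sum => j _; by rewrite normrM !mxE.
Qed.

End differentiability.

Lemma cvg_within_comp (R : realType) m (T : Type) (F : set_system T) {FF : Filter F}
    (h : T -> 'rV[R]_m) (D : set 'rV[R]_m) (f : 'rV[R]_m -> R) M :
  {within D, continuous f} -> D M -> (\forall t \near F, D (h t)) -> h @ F --> M ->
  (fun t => f (h t)) @ F --> f M.
Proof.
move=> /subspace_continuousP/(_ M) cf DM Dh hM A /(cf DM) fA.
have := hM _ fA; rewrite /= /fmap /= !near_simpl => H.
by apply: filterS2 Dh H => t /= Dt; exact.
Qed.

Lemma cvg_incr_near (R : realType) d (D : set 'rV[R]_d) k z (f : R -> R) (l : R) :
  (\forall t \near (0 : R), D (z + t *: unitv k)) ->
  f @ incr_filter D k z --> l -> f @ (0 : R)^' --> l.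
Proof.
move=> Dz; apply: cvg_trans => A fA.
have fA' : \forall t \near (0 : R), t != 0 -> D (z + t *: unitv k) -> A (f t) by exact: fA.
have : \forall t \near (0 : R), t != 0 -> A (f t).
  by apply: filterS2 Dz fA' => t Dt H t0; exact: H.
by [].
Qed.

Lemma near_line (R : realType) d (O : set 'rV[R]_d) k z :
  open O -> O z -> \forall t \near (0 : R), O (z + t *: unitv k).
Proof.
move=> Oo Oz; have : nbhs z O by exact: open_nbhs_nbhs.
move=> /near0_row[e e0 H]; apply/nbhs_ballP; exists e => //= t; rewrite /ball /= sub0r normrN => te.
by apply: H => j; rewrite !mxE eqxx; case: (j == k); rewrite ?mulr1// mulr0 normr0.
Qed.

(** At a boundary point of a quadrant only increments of one sign are available; these already make
    the filter proper. *)
Lemma proper_incr_near (R : realType) d (D : set 'rV[R]_d) k z :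
  (\forall t \near (0 : R), 0 <= t -> D (z + t *: unitv k)) ->
  ProperFilter (incr_filter D k z).
Proof.
move=> [e /= e0 He]; split; last exact: within_filter.
rewrite /incr_filter /within /= => -[r /= r0 Hr].
pose t := Num.min e r / 2.
have t0 : 0 < t by rewrite divr_gt0 ?lt_min ?e0.
have tl : t < Num.min e r by rewrite ltr_pdivrMr// ltr_pMr ?lt_min ?e0// ltr1n.
move: tl; rewrite lt_min => /andP[te tr].
apply: (Hr t) => /=; rewrite ?sub0r ?normrN ?gtr0_norm ?gt_eqF//.
by apply: He (ltW t0) => /=; rewrite sub0r normrN gtr0_norm.
Qed.

Lemma incr_filter_sub (R : realType) d d' (D : set 'rV[R]_d) (D' : set 'rV[R]_d') k k' z z' :
  (forall t, D (z + t *: unitv k) -> D' (z' + t *: unitv k')) ->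
  incr_filter D k z --> incr_filter D' k' z'.
Proof.
by move=> H A; apply: (@filterS _ (0 : R)^') => t /= DA /H; exact: DA.
Qed.

(** * Product domains: corners in the base, open fibres *)

Section fibred_domains.
Context {R : realType} {n N : nat}.
Implicit Types (Q : set 'rV[R]_n) (O : set 'rV[R]_N) (z : 'rV[R]_(n + N)).

Definition fdom Q O := [set z : 'rV[R]_(n + N) | Q (lsubmx z) /\ O (rsubmx z)].

Lemma lsubmx_lshift z (t : R) (a : 'I_n) :
  lsubmx (z + t *: unitv (lshift N a)) = lsubmx z + t *: unitv a.
Proof. by apply/rowP => i; rewrite !mxE !eqxx eq_lshift. Qed.

Lemma rsubmx_lshift z (t : R) (a : 'I_n) :
  rsubmx (z + t *: unitv (lshift N a)) = rsubmx z.
Proof. by apply/rowP => i; rewrite !mxE !eqxx eq_rlshift mulr0 addr0. Qed.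

Lemma lsubmx_rshift z (t : R) (a : 'I_N) :
  lsubmx (z + t *: unitv (rshift n a)) = lsubmx z.
Proof. by apply/rowP => i; rewrite !mxE !eqxx eq_lrshift mulr0 addr0. Qed.

Lemma rsubmx_rshift z (t : R) (a : 'I_N) :
  rsubmx (z + t *: unitv (rshift n a)) = rsubmx z + t *: unitv a.
Proof. by apply/rowP => i; rewrite !mxE !eqxx eq_rshift. Qed.

Lemma fdom_near Q O k z : quadrant_open Q -> open O -> fdom Q O z ->
  \forall t \near (0 : R), 0 <= t -> fdom Q O (z + t *: unitv k).
Proof.
move=> [J [U [Uo ->]]] Oo [[Uz Jz] Oz].
case: (split_ordP k) => a -> /=.
- apply: filterS (near_line a Uo Uz) => t Ht t0; split.
    rewrite lsubmx_lshift; split=> // i iJ; rewrite !mxE eqxx /=.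
    by rewrite addr_ge0 ?mulr_ge0//; have := Jz i iJ; rewrite mxE.
  by rewrite rsubmx_lshift.
- apply: filterS (near_line a Oo Oz) => t Ht t0; split.
    by rewrite lsubmx_rshift.
  by rewrite rsubmx_rshift.
Qed.

Lemma fdom_near_rshift Q O j z : open O -> fdom Q O z ->
  \forall t \near (0 : R), fdom Q O (z + t *: unitv (rshift n j)).
Proof.
move=> Oo [Qz Oz]; apply: filterS (near_line j Oo Oz) => t Ht.
by split; rewrite ?lsubmx_rshift// rsubmx_rshift.
Qed.

Lemma fdom_proper Q O : quadrant_open Q -> open O -> proper_increments (fdom Q O).
Proof.
by move=> Qq Oo k z Dz; apply: proper_incr_near; exact: fdom_near.
Qed.

Lemma open_proper O : open O -> proper_increments O.
Proof.
by move=> Oo k z Dz; apply: proper_incr_near; apply: filterS (near_line k Oo Dz) => t.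
Qed.

End fibred_domains.

Lemma split_lshift m n (a : 'I_m) : fintype.split (lshift n a) = inl a.
Proof. exact: (unsplitK (inl a)). Qed.

Lemma split_rshift m n (a : 'I_n) : fintype.split (rshift m a) = inr a.
Proof. exact: (unsplitK (inr a)). Qed.

Section base_functions.
Context {R : realType} {n N : nat}.
Variables (Q : set 'rV[R]_n) (O : set 'rV[R]_N) (f : 'rV[R]_n -> R).
Hypothesis Qq : quadrant_open Q.
Hypothesis Oo : open O.
Hypothesis fs : smooth_on Q f.

Let gen (w : seq 'I_n) (z : 'rV[R]_(n + N)) := pders Q w f (lsubmx z).
Let dgen (k : 'I_(n + N)) (w : seq 'I_n) : expr R (seq 'I_n) :=
  if fintype.split k is inl a then Gen (a :: w) else Cst 0.

(** Needed for the functions of the partition of unity, which depend on the base point only: their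
    fibre derivatives vanish. *)
Lemma smooth_on_lsubmx : smooth_on (fdom Q O) (fun z => f (lsubmx z)).
Proof.
apply: (@smooth_on_eval _ _ _ gen dgen _ (fdom_proper Qq Oo) _ _ _ (Gen [::])) => //.
- move=> w; apply/subspace_continuousP => z [Qz Oz].
  apply: (cvg_within_comp (fs w).1) => //.
    by apply: (@filterE _ (nbhs z)) => y [].
  by apply: cvg_trans (@continuous_lsubmx R 1 n N z); apply: cvg_app; exact: cvg_within.
- move=> k w z Dz; rewrite /dgen; case: (split_ordP k) => a ->.
    rewrite /=; have H := (fs w).2 a _ Dz.1.
    have {}H : diffq a (pders Q w f) (lsubmx z) @ incr_filter Q a (lsubmx z) -->
      pders Q (a :: w) f (lsubmx z) by exact: H.
    have -> : diffq (lshift N a) (gen w) z = diffq a (pders Q w f) (lsubmx z).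
      by apply/funext => t; rewrite /diffq /gen lsubmx_lshift.
    apply: cvg_trans H; apply: cvg_app; apply: incr_filter_sub => t [].
    by rewrite lsubmx_lshift.
  rewrite /=.
  apply: (@cvg_incr_eq _ _ _ _ _ (cst 0)); last exact: cvg_cst.
  by move=> t _ _; rewrite /diffq /gen lsubmx_rshift subrr mulr0.
Qed.

End base_functions.

(** * Change of variables in the fibres *)

Fixpoint emap (R G G' : Type) (h : G -> G') (e : expr R G) : expr R G' :=
  match e with
  | Cst c => Cst c
  | Gen g => Gen (h g)
  | Add e1 e2 => Add (emap h e1) (emap h e2)
  | Mul e1 e2 => Mul (emap h e1) (emap h e2)
  end.

Section pullback.
Context {R : realType} {n N : nat} {GN I : Type}.
Variables (Q : set 'rV[R]_n) (O1 O2 : set 'rV[R]_N).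
Hypotheses (Qq : quadrant_open Q) (O1o : open O1) (O2o : open O2).
Variables (fg : GN -> 'rV[R]_N -> R) (dfg : 'I_N -> GN -> expr R GN).
Hypothesis fg_cont : forall g, {within O1, continuous (fg g)}.
Hypothesis fg_diffq : forall k g y, O1 y ->
  diffq k (fg g) y @ incr_filter O1 k y --> eval fg (dfg k g) y.
Variable phi : 'I_N -> expr R GN.

Definition phimap (y : 'rV[R]_N) : 'rV[R]_N := \row_j eval fg (phi j) y.
Hypothesis phimapP : forall y, O1 y -> O2 (phimap y).
Variable B : I -> 'rV[R]_(n + N) -> R.
Hypothesis B_smooth : forall i, smooth_on (fdom Q O2) (B i).

Definition fibre_map (z : 'rV[R]_(n + N)) : 'rV[R]_(n + N) :=
  row_mx (lsubmx z) (phimap (rsubmx z)).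

Local Notation PG := (GN + I * seq 'I_(n + N))%type.

Definition pgen (g : PG) (z : 'rV[R]_(n + N)) : R := match g with
  | inl g => fg g (rsubmx z)
  | inr (i, w) => pders (fdom Q O2) w (B i) (fibre_map z)
  end.

(* In a fibre direction this is the chain rule; a base direction leaves the fibre
   generators constant. *)
Definition dpgen (k : 'I_(n + N)) (g : PG) : expr R PG :=
  match fintype.split k, g with
  | inl _, inl _ => Cst 0
  | inl _, inr (i, w) => Gen (inr (i, k :: w))
  | inr j, inl g => emap inl (dfg j g)
  | inr j, inr (i, w) => esum (enum 'I_N) (fun j' =>
      Mul (emap inl (der dfg j (phi j'))) (Gen (inr (i, rshift n j' :: w))))
  end.

Lemma eval_emap_inl e z : eval pgen (emap inl e) z = eval fg e (rsubmx z).
Proof. by elim: e => //= [e1 -> e2 ->|e1 -> e2 ->]. Qed.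

Lemma fibre_mapP z : fdom Q O1 z -> fdom Q O2 (fibre_map z).
Proof.
by move=> [Qz Oz]; split; rewrite /= /fibre_map ?row_mxKl// row_mxKr; exact: phimapP.
Qed.

Lemma cvg_fibre_map z : fdom Q O1 z ->
  fibre_map @ within (fdom Q O1) (nbhs z) --> fibre_map z.
Proof.
move=> Dz; apply: cvg_row => k; case: (split_ordP k) => j ->.
  rewrite row_mxEl; have -> : (fun t => fibre_map t 0 (lshift N j)) = fun t => t 0 (lshift N j).
    by apply/funext => t; rewrite row_mxEl mxE.
  rewrite mxE; apply: cvg_trans (@coord_continuous R 1 (n + N) 0 (lshift N j) z).
  by apply: cvg_app; exact: cvg_within.
rewrite row_mxEr mxE.
have -> : (fun t => fibre_map t 0 (rshift n j)) = fun t => eval fg (phi j) (rsubmx t).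
  by apply/funext => t; rewrite row_mxEr mxE.
apply: (cvg_within_comp (eval_continuous fg_cont (e := phi j))).
- by case: Dz.
- by apply: (@filterE _ (nbhs z)) => y [].
- by apply: cvg_trans (@continuous_rsubmx R 1 n N z); apply: cvg_app; exact: cvg_within.
Qed.

Lemma pgen_cont g : {within fdom Q O1, continuous (pgen g)}.
Proof.
apply/subspace_continuousP => z Dz; case: g => [g|[i w]] /=.
  apply: (cvg_within_comp (@fg_cont g)).
  - by case: Dz.
  - by apply: (@filterE _ (nbhs z)) => y [].
  - by apply: cvg_trans (@continuous_rsubmx R 1 n N z); apply: cvg_app; exact: cvg_within.
apply: (cvg_within_comp (B_smooth i w).1); first exact: fibre_mapP.
- by apply: (@filterE _ (nbhs z)) => y; exact: fibre_mapP.
- exact: cvg_fibre_map.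
Qed.

(** The base point is fixed along a fibre direction, so the chain rule is applied on the open set
    [O2] to the restriction of a derivative of [B i] to one fibre, along the curve [c]. All limits
    are two-sided there, even over a corner of the base. *)
Lemma pgen_diffq_fibre (j : 'I_N) i w z : fdom Q O1 z ->
  diffq (rshift n j) (pgen (inr (i, w))) z @ (0 : R)^' -->
    \sum_j' eval fg (der dfg j (phi j')) (rsubmx z) *
            pders (fdom Q O2) (rshift n j' :: w) (B i) (fibre_map z).
Proof.
move=> Dz; pose x := lsubmx z; pose y := rsubmx z.
have [Qx O1y] := Dz.
pose G (eta : 'rV[R]_N) := pders (fdom Q O2) w (B i) (row_mx x eta).
pose dG (j' : 'I_N) (eta : 'rV[R]_N) :=
  pders (fdom Q O2) (rshift n j' :: w) (B i) (row_mx x eta).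
pose c (t : R) := phimap (y + t *: unitv j).
have c0 : c 0 = phimap y by rewrite /c scale0r addr0.
have D2 eta : O2 eta -> fdom Q O2 (row_mx x eta).
  by move=> ?; split; rewrite /= ?row_mxKl// row_mxKr.
have dGP j' eta : O2 eta -> diffq j' G eta @ (0 : R)^' --> dG j' eta.
  move=> Oeta; have H := (B_smooth i w).2 (rshift n j') _ (D2 _ Oeta).
  have {}H : diffq (rshift n j') (pders (fdom Q O2) w (B i)) (row_mx x eta)
      @ incr_filter (fdom Q O2) (rshift n j') (row_mx x eta) --> dG j' eta by exact: H.
  have -> : diffq j' G eta = diffq (rshift n j') (pders (fdom Q O2) w (B i)) (row_mx x eta).
    apply/funext => t; rewrite /diffq /G; congr (_ * (pders _ _ _ _ - _)).
    rewrite -[RHS]hsubmxK lsubmx_rshift rsubmx_rshift row_mxKl row_mxKr //.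
  by apply: cvg_incr_near H; apply: fdom_near_rshift => //; exact: D2.
have dGc j' : dG j' @ c 0 --> dG j' (c 0).
  apply: (cvg_within_comp (B_smooth i (rshift n j' :: w)).1).
  - exact: (nbhs_filter (c 0)).
  - by apply: D2; rewrite c0; exact: phimapP.
  - have : nbhs (c 0) O2 by apply: open_nbhs_nbhs; split=> //; rewrite c0; exact: phimapP.
    by apply: filterS => eta; exact: D2.
  - apply: (@cvg_row _ _ _ _ (nbhs_filter (c 0))) => k; case: (split_ordP k) => a ->.
      rewrite row_mxEl; have -> : (fun t : 'rV[R]_N => row_mx x t 0 (lshift N a)) = cst (x 0 a).
        by apply/funext => t; rewrite row_mxEl.
      exact: cvg_cst.
    rewrite row_mxEr; have -> : (fun t : 'rV[R]_N => row_mx x t 0 (rshift n a)) = fun t => t 0 a.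
      by apply/funext => t; rewrite row_mxEr.
    exact: coord_continuous.
have cv j' : (fun t : R => t^-1 * (c t 0 j' - c 0 0 j')) @ (0 : R)^' -->
    eval fg (der dfg j (phi j')) y.
  have H := @eval_diffq _ _ _ fg dfg O1 (open_proper O1o) fg_diffq j (phi j') y O1y.
  have -> : (fun t : R => t^-1 * (c t 0 j' - c 0 0 j')) = diffq j (eval fg (phi j')) y.
    by apply/funext => t; rewrite c0 /c !mxE.
  by apply: cvg_incr_near H; exact: near_line.
have O2c : O2 (c 0) by rewrite c0; exact: phimapP.
have := diffq_chain O2o dGP O2c dGc cv.
have -> : (fun t : R => t^-1 * (G (c t) - G (c 0))) = diffq (rshift n j) (pgen (inr (i, w))) z.
  apply/funext => t; rewrite /diffq /pgen /G /fibre_map.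
  by rewrite lsubmx_rshift rsubmx_rshift c0.
by rewrite c0.
Qed.

Lemma pgen_diffq k g z : fdom Q O1 z ->
  diffq k (pgen g) z @ incr_filter (fdom Q O1) k z --> eval pgen (dpgen k g) z.
Proof.
move=> Dz; rewrite /dpgen; case: (split_ordP k) => j ->; case: g => [g|[i w]].
- apply: (@cvg_incr_eq _ _ _ _ _ (cst 0)); last exact: cvg_cst.
  by move=> t _ _; rewrite /diffq /= rsubmx_lshift subrr mulr0.
- have H := (B_smooth i w).2 (lshift N j) _ (fibre_mapP Dz).
  have {}H : diffq (lshift N j) (pders (fdom Q O2) w (B i)) (fibre_map z)
      @ incr_filter (fdom Q O2) (lshift N j) (fibre_map z) -->
      pders (fdom Q O2) (lshift N j :: w) (B i) (fibre_map z) by exact: H.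
  (* [fibre_map] commutes with translations along the base, so the two difference quotients coincide
     for every increment. *)
  have E t : fibre_map (z + t *: unitv (lshift N j)) = fibre_map z + t *: unitv (lshift N j).
    by rewrite -[RHS]hsubmxK lsubmx_lshift rsubmx_lshift row_mxKl row_mxKr /fibre_map
      lsubmx_lshift rsubmx_lshift.
  have -> : diffq (lshift N j) (pgen (inr (i, w))) z =
      diffq (lshift N j) (pders (fdom Q O2) w (B i)) (fibre_map z).
    by apply/funext => t; rewrite /diffq /= E.
  apply: cvg_trans H; apply: cvg_app; apply: incr_filter_sub => t /fibre_mapP.
  by rewrite E.
- rewrite eval_emap_inl; have H := @fg_diffq j g _ Dz.2.
  have -> : diffq (rshift n j) (pgen (inl g)) z = diffq j (fg g) (rsubmx z).
    by apply/funext => t; rewrite /diffq /= rsubmx_rshift.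
  apply: cvg_trans H; apply: cvg_app; apply: incr_filter_sub => t [_].
  by rewrite rsubmx_rshift.
- rewrite eval_esum big_enum /=.
  under eq_bigr do rewrite eval_emap_inl.
  by apply: cvg_trans (@pgen_diffq_fibre j i w z Dz); apply: cvg_app; exact: cvg_within.
Qed.

Definition smooth_on_pexpr := smooth_on_eval (fdom_proper Qq O1o) pgen_cont pgen_diffq.
Definition pders_pexpr := pders_eval (fdom_proper Qq O1o) pgen_diffq.

End pullback.

(** * Radial functions *)

Section squared_norm.
Context {R : realType} {N : nat}.
Implicit Types y : 'rV[R]_N.

Lemma sqn_ge0 y : 0 <= sqn y.
Proof. by apply: sumr_ge0 => i _; exact: sqr_ge0. Qed.

Lemma sqnZ (s : R) y : sqn (s *: y) = s ^+ 2 * sqn y.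
Proof. by rewrite /sqn mulr_sumr; apply: eq_bigr => i _; rewrite mxE exprMn. Qed.

Lemma sqn_line y (t : R) k : sqn (y + t *: unitv k) = sqn y + (t * (2 * y 0 k) + t ^+ 2).
Proof.
rewrite /sqn (bigD1 k)//= [in RHS](bigD1 k)//= !mxE !eqxx /= mulr1.
rewrite (eq_bigr (fun i => y 0 i ^+ 2)); first by ring.
by move=> i ik; rewrite !mxE (negbTE ik) andbF mulr0 addr0.
Qed.

Lemma sqn_continuous : continuous (@sqn R N).
Proof.
move=> y; have FF := nbhs_filter y; rewrite /sqn.
elim: (index_enum _) => [|i s IH].
  have -> : (fun x : 'rV[R]_N => \sum_(k <- [::]) x 0 k ^+ 2) = cst 0.
    by apply/funext => x; rewrite big_nil.
  exact: cst_continuous.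
have -> : (fun x : 'rV[R]_N => \sum_(k <- i :: s) x 0 k ^+ 2) =
    (fun x => x 0 i * x 0 i + \sum_(k <- s) x 0 k ^+ 2).
  by apply/funext => x; rewrite big_cons expr2.
by apply: (@cvgD _ _ _ _ FF) => //; apply: (@cvgM _ _ _ FF); exact: coord_continuous.
Qed.

Lemma diffq_radial (F : R -> R) y k (l : R) : is_derive (sqn y) 1 F l ->
  diffq k (F \o sqn) y @ (0 : R)^' --> l * (2 * y 0 k).
Proof.
move=> HF.
(* Along a coordinate line the squared norm is this quadratic polynomial in [t], which reduces the
   claim to the chain rule in one variable. *)
pose rho (t : R) : R := sqn y + (t * (2 * y 0 k) + t ^+ 2).
have rho0 : rho 0 = sqn y by rewrite /rho mul0r expr0n /= !addr0.
have Hrho : is_derive (0 : R) 1 rho (2 * y 0 k).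
  by apply: is_derive_eq; rewrite /GRing.scale /=; ring.
rewrite -rho0 in HF.
have [H1 H2] := @is_derive1_comp R F rho 0 _ _ HF Hrho.
rewrite -H2; have := H1; rewrite /derivable /derive.
have -> : (fun h : R => h^-1 *: (((F \o rho) \o shift 0) (h *: 1) - (F \o rho) 0)) =
    diffq k (F \o sqn) y.
  apply/funext => h; rewrite /diffq /= sqn_line rho0 /rho addr0.
  by rewrite -[h *: 1]/(h * 1) mulr1.
by [].
Qed.

End squared_norm.

(* [Co j] is the j-th coordinate; the others are functions of [r = |y|^2], and
   [rC + i rS] is [exp ((m + i tau) lam)]. *)
Inductive rad (N : nat) := Co of 'I_N | rU | rV | rC | rS.
Arguments Co {N}.
Arguments rU {N}.
Arguments rV {N}.
Arguments rC {N}.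
Arguments rS {N}.

Section radial.
Context {R : realType} {N : nat}.
Variables (fu fv lam : R -> R) (m tau : R) (du dv dlam : expr R (rad N)).
Local Notation expr := (expr R (rad N)).

(** The coordinates are not radial; the value 0 for [Co] is a filler, and [rgen] treats them
    separately. *)
Definition rfun (g : rad N) (r : R) : R := match g with
  | Co _ => 0
  | rU => fu r
  | rV => fv r
  | rC => expR (m * lam r) * cos (tau * lam r)
  | rS => expR (m * lam r) * sin (tau * lam r)
  end.

Definition rgen (g : rad N) (y : 'rV[R]_N) : R :=
  if g is Co j then y 0 j else rfun g (sqn y).

Definition drfun (g : rad N) : expr := match g with
  | Co _ => Cst 0
  | rU => du
  | rV => dv
  | rC => Mul dlam (Add (Mul (Cst m) (Gen rC)) (Mul (Cst (- tau)) (Gen rS)))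
  | rS => Mul dlam (Add (Mul (Cst m) (Gen rS)) (Mul (Cst tau) (Gen rC)))
  end.

Definition drgen (k : 'I_N) (g : rad N) : expr :=
  if g is Co j then Cst (j == k)%:R else Mul (drfun g) (Mul (Cst 2) (Gen (Co k))).

Variable O : set 'rV[R]_N.
Hypothesis duP : forall y, O y -> is_derive (sqn y) 1 fu (eval rgen du y).
Hypothesis dvP : forall y, O y -> is_derive (sqn y) 1 fv (eval rgen dv y).
Hypothesis dlamP : forall y, O y -> is_derive (sqn y) 1 lam (eval rgen dlam y).

Lemma drfunP g y : O y -> is_derive (sqn y) 1 (rfun g) (eval rgen (drfun g) y).
Proof.
move=> Oy; case: g => [j||||] /=.
- exact: is_derive_cst.
- exact: duP.
- exact: dvP.
- have dl := dlamP Oy.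
  have He : is_derive (sqn y) 1 (fun r => expR (m * lam r))
    (expR (m * lam (sqn y)) * (m * eval rgen dlam y)).
    apply: (@is_derive1_comp R expR (fun r => m * lam r)).
  have Hc : is_derive (sqn y) 1 (fun r => cos (tau * lam r))
    (- sin (tau * lam (sqn y)) * (tau * eval rgen dlam y)).
    apply: (@is_derive1_comp R cos (fun r => tau * lam r)).
  have H : is_derive (sqn y) 1 (rfun rC) _ := is_deriveM He Hc.
  apply: (is_derive_eq H).
  rewrite /GRing.scale /=; ring.
- have dl := dlamP Oy.
  have He : is_derive (sqn y) 1 (fun r => expR (m * lam r))
    (expR (m * lam (sqn y)) * (m * eval rgen dlam y)).
    apply: (@is_derive1_comp R expR (fun r => m * lam r)).
  have Hc : is_derive (sqn y) 1 (fun r => sin (tau * lam r))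
    (cos (tau * lam (sqn y)) * (tau * eval rgen dlam y)).
    apply: (@is_derive1_comp R sin (fun r => tau * lam r)).
  have H : is_derive (sqn y) 1 (rfun rS) _ := is_deriveM He Hc.
  apply: (is_derive_eq H).
  rewrite /GRing.scale /=; ring.
Qed.

Lemma rgen_cont g : {within O, continuous (rgen g)}.
Proof.
apply: continuous_in_subspaceT => y; rewrite inE => Oy.
case: (pselect (exists j, g = Co j)) => [[j ->]|ng]; first exact: coord_continuous.
have -> : rgen g = rfun g \o sqn.
  by apply/funext => x; case: g ng => // j []; exists j.
apply: continuous_comp; first exact: sqn_continuous.
have [H _] := drfunP g Oy.
exact/differentiable_continuous/derivable1_diffP.
Qed.

Lemma rgen_diffq k g y : O y ->
  diffq k (rgen g) y @ incr_filter O k y --> eval rgen (drgen k g) y.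
Proof.
move=> Oy; suff : diffq k (rgen g) y @ (0 : R)^' --> eval rgen (drgen k g) y.
  by apply: cvg_trans; apply: cvg_app; exact: cvg_within.
case: (pselect (exists j, g = Co j)) => [[j ->]|ng].
  apply: (@cvg_dnbhs_eq _ (cst (j == k)%:R)); last exact: cvg_cst.
  move=> t t0; rewrite /diffq /= !mxE eqxx /= [y 0 j + _]addrC addrK.
  by rewrite mulKf.
have E1 : rgen g = rfun g \o sqn.
  by apply/funext => x; case: g ng => // j []; exists j.
have -> : eval rgen (drgen k g) y = eval rgen (drfun g) y * (2 * y 0 k).
  by case: g ng {E1} => // j []; exists j.
by rewrite E1; apply: diffq_radial; exact: drfunP.
Qed.

End radial.

Section japanese_bracket.
Context {R : realType} {N : nat}.
Implicit Types y : 'rV[R]_N.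

Definition bra y : R := Num.sqrt (1 + sqn y).

Lemma bra_ge1 y : 1 <= bra y.
Proof. by rewrite /bra -{1}sqrtr1 ler_sqrt ?lerDl ?sqn_ge0// addr_ge0// sqn_ge0. Qed.

Lemma bra_gt0 y : 0 < bra y.
Proof. exact: lt_le_trans ltr01 (bra_ge1 y). Qed.

Lemma bra_sqr y : bra y ^+ 2 = 1 + sqn y.
Proof. by rewrite sqr_sqrtr// addr_ge0// sqn_ge0. Qed.

Lemma coord_le_bra y j : `|y 0 j| <= bra y.
Proof.
have b0 := ltW (bra_gt0 y).
rewrite -(@ler_pXn2r _ 2)// bra_sqr real_normK ?num_real//.
rewrite /sqn (bigD1 j)//= addrCA lerDl; apply: addr_ge0 => //.
by apply: sumr_ge0 => i _; exact: sqr_ge0.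
Qed.

Lemma unball_bra y : sqn y < 1 -> bra (unball y) = (1 + sqn y) / (1 - sqn y).
Proof.
move=> y1; have y0 := sqn_ge0 y.
have h : 1 - sqn y != 0 by rewrite subr_eq0 gt_eqF.
rewrite /bra /unball sqnZ.
have -> : 1 + (2 / (1 - sqn y)) ^+ 2 * sqn y = ((1 + sqn y) / (1 - sqn y)) ^+ 2.
  by field.
by rewrite sqrtr_sqr ger0_norm//; apply: divr_ge0; [exact: addr_ge0|rewrite subr_ge0 ltW].
Qed.

Definition toball y : 'rV[R]_N := (1 + bra y)^-1 *: y.

Lemma sqn_toball y : sqn (toball y) = (bra y - 1) / (bra y + 1).
Proof.
have h : bra y + 1 != 0 by rewrite gt_eqF// addr_gt0 ?bra_gt0.
have E : sqn y = bra y ^+ 2 - 1 by rewrite bra_sqr addrC addKr.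
by rewrite /toball sqnZ E; field.
Qed.

Lemma sqn_toball_lt1 y : sqn (toball y) < 1.
Proof.
by rewrite sqn_toball ltr_pdivrMr ?addr_gt0 ?bra_gt0// mul1r ltrBlDr -addrA ltrDl.
Qed.

Lemma toballK y : unball (toball y) = y.
Proof.
rewrite /unball sqn_toball /toball scalerA.
have h : bra y + 1 != 0 by rewrite gt_eqF// addr_gt0 ?bra_gt0.
rewrite (_ : _ * _ = 1) ?scale1r//; field.
rewrite addrC h /= (_ : _ - _ = 2) ?pnatr_eq0//; ring.
Qed.

End japanese_bracket.

Lemma cpowE (R : realType) (t : R) (mu : R[i]) : 0 < t ->
  cpow t mu = Complex (expR (complex.Re mu * ln t) * cos (complex.Im mu * ln t))
                      (expR (complex.Re mu * ln t) * sin (complex.Im mu * ln t)).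
Proof. by move=> t0; rewrite /cpow /powR gt_eqF. Qed.

Lemma cpowN (R : realType) (t : R) (mu : R[i]) : 0 < t -> cpow t mu * cpow t (- mu) = 1.
Proof.
move=> t0; rewrite !cpowE//; case: mu => a b /=.
rewrite !mulNr cosN sinN; set x := a * ln t; set y := b * ln t.
have E : expR x * expR (- x) = 1 by rewrite -expRD subrr expR0.
have C := cos2Dsin2 y.
apply/eqP; rewrite eq_complex /=; apply/andP; split; apply/eqP.
  transitivity ((expR x * expR (- x)) * (cos y ^+ 2 + sin y ^+ 2)); first by ring.
  by rewrite E C mulr1.
by ring.
Qed.

(** * The two directions of the radial compactification *)

Section ball_instance.
Context {R : realType} {N : nat}.
Variables (m tau : R).

(** With [r = sqn y], [lamball] is the logarithm of [bra (unball y)], its derivative is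
    [uball + vball], and [unball y] is [2 * uball r] times [y]. These functions are thus closed
    under differentiation and express both the map and the weight. *)
Definition uball (r : R) := (1 - r)^-1.
Definition vball (r : R) := (1 + r)^-1.
Definition lamball (r : R) := ln (1 + r) - ln (1 - r).
Definition duball : expr R (rad N) := Mul (Gen rU) (Gen rU).
Definition dvball : expr R (rad N) := Mul (Cst (-1)) (Mul (Gen rV) (Gen rV)).
Definition dlamball : expr R (rad N) := Add (Gen rU) (Gen rV).
Definition phiball (j : 'I_N) : expr R (rad N) := Mul (Mul (Cst 2) (Gen rU)) (Gen (Co j)).

Local Notation ev := (eval (rgen uball vball lamball m tau)).
Definition oball : set 'rV[R]_N := [set y | sqn y < 1].

Lemma oball_open : open oball.
Proof.
have -> : oball = (@sqn R N) @^-1` [set x : R | x < 1] by [].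
by apply: open_comp; [move=> y _; exact: sqn_continuous|exact: open_lt].
Qed.

Lemma duballP y : oball y -> is_derive (sqn y) 1 uball (ev duball y).
Proof.
move=> y1; have h : 1 - sqn y != 0 by rewrite subr_eq0 gt_eqF.
rewrite /uball; apply: is_derive_eq; rewrite /= /uball /GRing.scale /=; by field.
Qed.

Lemma dvballP y : oball y -> is_derive (sqn y) 1 vball (ev dvball y).
Proof.
move=> y1; have h : 1 + sqn y != 0 by rewrite gt_eqF// ltr_pwDl// sqn_ge0.
rewrite /vball; apply: is_derive_eq; rewrite /= /vball /GRing.scale /=; by field.
Qed.

Lemma dlamballP y : oball y -> is_derive (sqn y) 1 lamball (ev dlamball y).
Proof.
move=> y1; have h : 0 < 1 - sqn y by rewrite subr_gt0.
have h' : 0 < 1 + sqn y by rewrite ltr_pwDl// sqn_ge0.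
have d1 : is_derive (sqn y) 1 (fun r : R => ln (1 + r)) ((1 + sqn y)^-1 * 1).
  have d : is_derive (sqn y) 1 (fun r : R => 1 + r) 1.
    by apply: is_derive_eq; ring.
  exact: (@is_derive1_comp R (@ln R) (fun r => 1 + r) _ _ _ (is_derive1_ln h') d).
have d2 : is_derive (sqn y) 1 (fun r : R => ln (1 - r)) ((1 - sqn y)^-1 * -1).
  have d : is_derive (sqn y) 1 (fun r : R => 1 - r) (- 1).
    by apply: is_derive_eq; ring.
  exact: (@is_derive1_comp R (@ln R) (fun r => 1 - r) _ _ _ (is_derive1_ln h) d).
have H : is_derive (sqn y) 1 lamball _ := is_deriveB d1 d2.
apply: (is_derive_eq H).
by rewrite /= /uball /vball mulr1 mulrN1 opprK addrC.
Qed.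

Lemma phiballE y : phimap (rgen uball vball lamball m tau) phiball y = unball y.
Proof. by apply/rowP => j; rewrite !mxE. Qed.

End ball_instance.

Section plane_instance.
Context {R : realType} {N : nat}.
Variables (m tau : R).

(** The counterparts on the whole fibre, with [r = sqn y]: [uplane] is the inverse of the bracket,
    [vplane] is the factor of [y] in [toball], and [lamplane] is the logarithm of the bracket, so
    that [rC] and [rS] are the parts of its complex power. *)
Definition uplane (r : R) := (Num.sqrt (1 + r))^-1.
Definition vplane (r : R) := (1 + Num.sqrt (1 + r))^-1.
Definition lamplane (r : R) := ln (Num.sqrt (1 + r)).
Definition duplane : expr R (rad N) :=
  Mul (Cst (- 2^-1)) (Mul (Gen rU) (Mul (Gen rU) (Gen rU))).
Definition dvplane : expr R (rad N) :=
  Mul (Cst (- 2^-1)) (Mul (Gen rU) (Mul (Gen rV) (Gen rV))).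
Definition dlamplane : expr R (rad N) := Mul (Cst 2^-1) (Mul (Gen rU) (Gen rU)).
Definition phiplane (j : 'I_N) : expr R (rad N) := Mul (Gen rV) (Gen (Co j)).

Local Notation ev := (eval (rgen uplane vplane lamplane m tau)).

Lemma is_derive_bra (y : 'rV[R]_N) :
  is_derive (sqn y) 1 (fun r : R => Num.sqrt (1 + r)) ((2 * bra y)^-1).
Proof.
have h : 0 < 1 + sqn y by rewrite ltr_pwDl// sqn_ge0.
rewrite -[X in is_derive _ _ _ X]mulr1.
have d : is_derive (sqn y) 1 (fun r : R => 1 + r) 1.
  by apply: is_derive_eq; ring.
exact: (@is_derive1_comp R (@Num.sqrt R) (fun r => 1 + r) _ _ _ (is_derive1_sqrt h) d).
Qed.

Lemma duplaneP y : is_derive (sqn y) 1 uplane (ev duplane y).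
Proof.
have h : bra y != 0 by rewrite gt_eqF// bra_gt0.
have h2 : Num.sqrt (1 + sqn y) != 0 by exact: h.
have d := is_derive_bra y.
have H : is_derive (sqn y) 1 uplane _ :=
  @is_deriveV R (fun r => Num.sqrt (1 + r)) _ _ _ h2 d.
apply: (is_derive_eq H).
by rewrite /= /uplane -/(bra y) /GRing.scale /=; field.
Qed.

Lemma dvplaneP y : is_derive (sqn y) 1 vplane (ev dvplane y).
Proof.
have h : bra y != 0 by rewrite gt_eqF// bra_gt0.
have h2 : 1 + Num.sqrt (1 + sqn y) != 0 by rewrite gt_eqF// addr_gt0// (bra_gt0 y).
have d : is_derive (sqn y) 1 (fun r : R => 1 + Num.sqrt (1 + r)) (2 * bra y)^-1.
  rewrite -[X in is_derive _ _ _ X]add0r; apply: is_deriveD; exact: is_derive_bra.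
have H : is_derive (sqn y) 1 vplane _ :=
  @is_deriveV R (fun r => 1 + Num.sqrt (1 + r)) _ _ _ h2 d.
apply: (is_derive_eq H).
by rewrite /= /uplane /vplane -/(bra y) /GRing.scale /=; field; rewrite h h2.
Qed.

Lemma dlamplaneP y : is_derive (sqn y) 1 lamplane (ev dlamplane y).
Proof.
have h : bra y != 0 by rewrite gt_eqF// bra_gt0.
have h2 : 0 < Num.sqrt (1 + sqn y) by exact: (bra_gt0 y).
have H : is_derive (sqn y) 1 lamplane _ :=
  @is_derive1_comp R _ (fun r => Num.sqrt (1 + r)) _ _ _ (is_derive1_ln h2) (is_derive_bra y).
apply: (is_derive_eq H).
by rewrite /= /uplane -/(bra y); field.
Qed.

Lemma phiplaneE y : phimap (rgen uplane vplane lamplane m tau) phiplane y = toball y.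
Proof. by apply/rowP => j; rewrite !mxE. Qed.

End plane_instance.

(** * Symbol orders and the comparison of seminorms *)

Section order.
Context {R : realType} {n N : nat}.
Variables (m tau : R).
Local Notation PG := (rad N + bool * seq 'I_(n + N))%type.

Definition dplane : 'I_(n + N) -> PG -> expr R PG :=
  dpgen (drgen m tau (@duplane R N) dvplane dlamplane) phiplane.

(* [ord W b r e]: [e] is of order [r] in the fibre variables, involves only the
   derivatives [w] in [W] of the base functions, and is linear in them if [b] holds. *)
Inductive ord (W : set (seq 'I_(n + N))) : bool -> R -> expr R PG -> Prop :=
| ord0 b r : ord W b r (Cst 0)
| ordC c : ord W false 0 (Cst c)
| ordCo j : ord W false 1 (Gen (inl (Co j)))
| ordU : ord W false (-1) (Gen (inl rU))
| ordV : ord W false (-1) (Gen (inl rV))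
| ordRC : ord W false m (Gen (inl rC))
| ordRS : ord W false m (Gen (inl rS))
| ordB i w : W w -> ord W true 0 (Gen (inr (i, w)))
| ordA b r e e' : ord W b r e -> ord W b r e' -> ord W b r (Add e e')
| ordMl b r r' e e' : ord W b r e -> ord W false r' e' -> ord W b (r + r') (Mul e e')
| ordMr b r r' e e' : ord W false r e -> ord W b r' e' -> ord W b (r + r') (Mul e e').

Lemma ord_eq W b r r' e : ord W b r e -> r = r' -> ord W b r' e.
Proof. by move=> + <-. Qed.

Lemma ord_esum W b r (J : Type) (s : seq J) F : (forall j, ord W b r (F j)) ->
  ord W b r (esum s F).
Proof. by move=> H; elim: s => [|j s IH] /=; [exact: ord0|exact: ordA]. Qed.

Lemma ordS W W' b r e : W `<=` W' -> ord W b r e -> ord W' b r e.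
Proof. by move=> WW'; elim; intros; try (by constructor => //; exact: WW'). Qed.

Lemma ord_rCo W (k : 'I_N) : ord W false 1 (Mul (Cst 2) (Gen (inl (Co k)))).
Proof. by apply: ord_eq; [apply: ordMl; constructor|rewrite add0r]. Qed.

Lemma ord_dU W (k : 'I_N) : ord W false (-2)
  (emap inl (drgen m tau duplane dvplane dlamplane k rU)).
Proof.
apply: ord_eq => /=.
  by apply: ordMl; [do !apply: ordMl; constructor|exact: ord_rCo].
by lra.
Qed.

Lemma ord_dV W (k : 'I_N) : ord W false (-2)
  (emap inl (drgen m tau duplane dvplane dlamplane k rV)).
Proof.
apply: ord_eq => /=.
  by apply: ordMl; [do !apply: ordMl; constructor|exact: ord_rCo].
by lra.
Qed.

Lemma ord_der_fibre W b r e (k : 'I_N) :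
  (forall j w, W w -> W (rshift n j :: w)) ->
  ord W b r e -> ord W b (r - 1) (der dplane (rshift n k) e).
Proof.
move=> WS; elim=> {b r e} /=.
- by move=> b r; exact: ord0.
- by move=> c; exact: ord0.
- move=> j; rewrite /dplane /dpgen split_rshift /=.
  by apply: ord_eq; [exact: ordC|rewrite subrr].
- rewrite /dplane /dpgen split_rshift; apply: ord_eq; [exact: ord_dU|by lra].
- rewrite /dplane /dpgen split_rshift; apply: ord_eq; [exact: ord_dV|by lra].
- rewrite /dplane /dpgen split_rshift /=; apply: ord_eq.
    apply: ordMl; last exact: ord_rCo.
    apply: ordMl; first by do !apply: ordMl; constructor.
    by apply: ordA; apply: ordMl; constructor.
  by lra.
- rewrite /dplane /dpgen split_rshift /=; apply: ord_eq.
    apply: ordMl; last exact: ord_rCo.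
    apply: ordMl; first by do !apply: ordMl; constructor.
    by apply: ordA; apply: ordMl; constructor.
  by lra.
- move=> i w Ww; rewrite /dplane /dpgen split_rshift; apply: ord_esum => j.
  (* By the chain rule the new derivative of [B i], still of order 0, is multiplied by a derivative
     of [toball]. Both terms of the latter have order -1: [vplane] itself, and a derivative of
     [vplane], of order -2, times a coordinate. *)
  rewrite sub0r -[- 1]addr0; apply: ordMr; last by constructor; exact: WS.
  apply: ordA.
    apply: ord_eq; first by apply: ordMl; [exact: ord_dV|exact: ordCo].
    by lra.
  by apply: ord_eq; [apply: ordMl; constructor|rewrite addr0].
- by move=> b r e e' _ IH _ IH'; exact: ordA.
- move=> b r r' e e' He IH He' IH'; apply: ordA.
    by apply: ord_eq; [apply: ordMl; [exact: IH|exact: He']|ring].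
  by apply: ord_eq; [apply: ordMl; [exact: He|exact: IH']|ring].
- move=> b r r' e e' He IH He' IH'; apply: ordA.
    by apply: ord_eq; [apply: ordMr; [exact: IH|exact: He']|ring].
  by apply: ord_eq; [apply: ordMr; [exact: He|exact: IH']|ring].
Qed.

Lemma ord_der_base W b r e (k : 'I_n) :
  (forall j w, W w -> W (lshift N j :: w)) ->
  ord W b r e -> ord W b r (der dplane (lshift N k) e).
Proof.
move=> WS; elim=> {b r e} /=; rewrite /dplane /dpgen ?split_lshift.
- by move=> b r; exact: ord0.
- by move=> c; exact: ord0.
- by move=> j; exact: ord0.
- exact: ord0.
- exact: ord0.
- exact: ord0.
- exact: ord0.
- by move=> i w Ww; constructor; exact: WS.
- by move=> b r e e' _ IH _ IH'; exact: ordA.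
- move=> b r r' e e' He IH He' IH'; apply: ordA; exact: ordMl.
- move=> b r r' e e' He IH He' IH'; apply: ordA; exact: ordMr.
Qed.

(** [Scl_norm] involves only words with all base letters in front of the fibre letters. Fibre
    derivatives are taken first, which produces the words of [base_words]; base derivatives then
    prepend base letters. The words therefore stay in this form, and mixed derivatives never have to
    be interchanged. *)
Definition base_words : set (seq 'I_(n + N)) := [set w | exists be, w = @fword n N be].
Definition mixed_words : set (seq 'I_(n + N)) :=
  [set w | exists al be, w = @xword n N al ++ @fword n N be].

Lemma ord_ders r e al be : ord base_words true r e ->
  ord mixed_words true (r - (size be)%:R) (ders dplane (@xword n N al ++ @fword n N be) e).
Proof.
move=> He; rewrite /ders foldr_cat.
have H : ord base_words true (r - (size be)%:R) (foldr (der dplane) e (@fword n N be)).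
  elim: be => [|k be IH] /=; first by rewrite subr0.
  apply: ord_eq; first by apply: ord_der_fibre IH => j _ [be' ->]; exists (j :: be').
  by rewrite -addn1 natrD; ring.
have {}H : ord mixed_words true (r - (size be)%:R) (foldr (der dplane) e (@fword n N be)).
  by apply: ordS H => _ [be' ->]; exists [::], be'.
elim: al => [|k al IH] //=.
by apply: ord_der_base IH => j _ [al' [be' ->]]; exists (j :: al'), be'.
Qed.

Local Notation pg Q B := (pgen Q (@oball R N) (rgen uplane vplane lamplane m tau) phiplane B).
Local Notation fmap2 := (@fibre_map R n N _ (rgen uplane vplane lamplane m tau) phiplane).

(** The constant and the finite set of words are read off from the syntax of [e], before [Q], [B]
    and the point are given; this yields uniformity over the charts. In a product at most one factor
    carries [dl], so the bound is linear in the size of the derivatives of [B]. *)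
Lemma ord_bound W b r e : ord W b r e ->
  exists (c : R) (F : seq (seq 'I_(n + N))), [/\ 0 <= c, (forall w, w \in F -> W w) &
    forall Q B (dl : R) z, 0 <= dl ->
      (forall i w, w \in F -> `|pders (fdom Q (@oball R N)) w (B i) (fmap2 z)| <= dl) ->
      `|eval (pg Q B) e z| <= c * (if b then dl else 1) * bra (rsubmx z) `^ r].
Proof.
elim=> {b r e}.
- move=> b r; exists 0, [::]; split=> // Q B dl z _ _ /=.
  by rewrite normr0 !mul0r.
- move=> c; exists `|c|, [::]; split=> // Q B dl z _ _ /=.
  by rewrite powRr0 !mulr1.
- move=> j; exists 1, [::]; split=> // Q B dl z _ _ /=.
  by rewrite !mul1r powRr1 ?coord_le_bra// ltW// bra_gt0.
- exists 1, [::]; split=> // Q B dl z _ _ /=.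
  have b0 := bra_gt0 (rsubmx z); have b1 := ltW b0.
  rewrite /rgen /= /uplane -/(bra (rsubmx z)) !mul1r powR_inv1//.
  by rewrite ger0_norm// invr_ge0.
- exists 1, [::]; split=> // Q B dl z _ _ /=.
  have b0 := bra_gt0 (rsubmx z); have b1 := ltW b0.
  rewrite /rgen /= /vplane -/(bra (rsubmx z)) !mul1r powR_inv1//.
  by rewrite ger0_norm ?invr_ge0 ?addr_ge0// lef_pV2 ?posrE ?addr_gt0// lerDr.
- exists 1, [::]; split=> // Q B dl z _ _ /=.
  rewrite /rgen /= /lamplane -/(bra (rsubmx z)) !mul1r /powR gt_eqF ?bra_gt0//.
  rewrite normrM ger0_norm ?expR_ge0// ler_piMr ?expR_ge0//.
  by rewrite ler_norml cos_geN1 cos_le1.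
- exists 1, [::]; split=> // Q B dl z _ _ /=.
  rewrite /rgen /= /lamplane -/(bra (rsubmx z)) !mul1r /powR gt_eqF ?bra_gt0//.
  rewrite normrM ger0_norm ?expR_ge0// ler_piMr ?expR_ge0//.
  by rewrite ler_norml sin_geN1 sin_le1.
- move=> i w Ww; exists 1, [:: w]; split=> //.
    by move=> w'; rewrite inE => /eqP ->.
  move=> Q B dl z _ H /=; rewrite powRr0 mul1r mulr1; apply: H; exact: mem_head.
- move=> b r e e' _ [c [F [c0 FW H]]] _ [c' [F' [c'0 F'W H']]].
  exists (c + c'), (F ++ F'); split; first exact: addr_ge0.
    by move=> w; rewrite mem_cat => /orP[/FW|/F'W].
  move=> Q B dl z dl0 HB /=; rewrite !mulrDl.
  apply: le_trans (ler_normD _ _) _; apply: lerD.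
    by apply: (H Q B dl z) => // i w wF; apply: HB; rewrite mem_cat wF.
  by apply: H' => // i w wF; apply: HB; rewrite mem_cat wF orbT.
- move=> b r r' e e' _ [c [F [c0 FW H]]] _ [c' [F' [c'0 F'W H']]].
  exists (c * c'), (F ++ F'); split; first exact: mulr_ge0.
    by move=> w; rewrite mem_cat => /orP[/FW|/F'W].
  move=> Q B dl z dl0 HB /=.
  rewrite powRD; last by apply/implyP => _; rewrite gt_eqF ?bra_gt0.
  rewrite normrM (_ : _ * _ = (c * (if b then dl else 1) * bra (rsubmx z) `^ r) *
    (c' * 1 * bra (rsubmx z) `^ r')); last by ring.
  apply: ler_pM => //.
    by apply: (H Q B dl z) => // i w wF; apply: HB; rewrite mem_cat wF.
  by apply: (H' Q B dl z) => // i w wF; apply: HB; rewrite mem_cat wF orbT.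
- move=> b r r' e e' _ [c [F [c0 FW H]]] _ [c' [F' [c'0 F'W H']]].
  exists (c * c'), (F ++ F'); split; first exact: mulr_ge0.
    by move=> w; rewrite mem_cat => /orP[/FW|/F'W].
  move=> Q B dl z dl0 HB /=.
  rewrite powRD; last by apply/implyP => _; rewrite gt_eqF ?bra_gt0.
  rewrite normrM (_ : _ * _ = (c * 1 * bra (rsubmx z) `^ r) *
    (c' * (if b then dl else 1) * bra (rsubmx z) `^ r')); last by ring.
  apply: ler_pM => //.
    by apply: (H Q B dl z) => // i w wF; apply: HB; rewrite mem_cat wF.
  by apply: H' => // i w wF; apply: HB; rewrite mem_cat wF orbT.
Qed.

End order.

Section complex_modulus.
Context {R : realType}.
Implicit Types (a b : R) (z : R[i]).

Lemma cabsE a b : cabs (Complex a b) = Num.sqrt (a ^+ 2 + b ^+ 2).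
Proof. by []. Qed.

Lemma Re_le_cabs z : `|complex.Re z| <= cabs z.
Proof.
by case: z => a b; rewrite cabsE /= -sqrtr_sqr ler_sqrt ?addr_ge0 ?sqr_ge0// lerDl sqr_ge0.
Qed.

Lemma Im_le_cabs z : `|complex.Im z| <= cabs z.
Proof.
by case: z => a b; rewrite cabsE /= -sqrtr_sqr ler_sqrt ?addr_ge0 ?sqr_ge0// lerDr sqr_ge0.
Qed.

Lemma cabs_le z : cabs z <= `|complex.Re z| + `|complex.Im z|.
Proof.
case: z => a b; rewrite cabsE /= -[leRHS]ger0_norm ?addr_ge0// -sqrtr_sqr ler_wsqrtr//.
rewrite sqrrD !real_normK ?num_real// addrAC lerDl.
by rewrite mulrn_wge0// mulr_ge0.
Qed.

Lemma Re_mulc (x y : R[i]) : complex.Re (x * y) =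
  complex.Re x * complex.Re y - complex.Im x * complex.Im y.
Proof. by case: x y => [a b] [c d]. Qed.

Lemma Im_mulc (x y : R[i]) : complex.Im (x * y) =
  complex.Re x * complex.Im y + complex.Im x * complex.Re y.
Proof. by case: x y => [a b] [c d]. Qed.

End complex_modulus.

(** * The comparison of seminorms in one chart *)

Section flat_estimate.
Context {R : realType} {n N : nat}.
Variable mu : R[i].
Implicit Types (Q : set 'rV[R]_n) (h : 'rV[R]_(n + N) -> R[i]).
Local Notation PG := (rad N + bool * seq 'I_(n + N))%type.

Definition ball_fun h (z : 'rV[R]_(n + N)) : R[i] :=
  cpow (bra (unball (rsubmx z))) (- mu) * h (row_mx (lsubmx z) (unball (rsubmx z))).

Definition reim h (b : bool) (z : 'rV[R]_(n + N)) : R :=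
  if b then complex.Re (h z) else complex.Im (h z).

(** Real part of the product of [rC + i rS] with a complex function given by its two parts. It
    serves in both directions: with exponent [- mu] for passing to the ball and with exponent [mu]
    for passing back. *)
Definition re_expr : expr R PG :=
  Add (Mul (Gen (inl rC)) (Gen (inr (true, [::]))))
      (Mul (Cst (-1)) (Mul (Gen (inl rS)) (Gen (inr (false, [::]))))).

Definition im_expr : expr R PG :=
  Add (Mul (Gen (inl rC)) (Gen (inr (false, [::]))))
      (Mul (Gen (inl rS)) (Gen (inr (true, [::])))).

Let gball := rgen (@uball R) vball lamball (complex.Re (- mu)) (complex.Im (- mu)) (N := N).
Let gplane := rgen (@uplane R) vplane lamplane (complex.Re mu) (complex.Im mu) (N := N).

Lemma reim_smooth Q h O : csmooth_on (fdom Q O) h -> forall b, smooth_on (fdom Q O) (reim h b).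
Proof. by move=> [hr hi] []. Qed.

Lemma ball_fun_cpow (y : 'rV[R]_N) : oball y -> cpow (bra (unball y)) (- mu) =
  Complex (gball rC y) (gball rS y).
Proof.
move=> y1; rewrite cpowE ?bra_gt0// unball_bra// ln_div ?posrE ?subr_gt0 ?ltr_pwDl ?sqn_ge0//.
Qed.

Lemma ball_fun_eval Q h z : fdom Q (@oball R N) z ->
  complex.Re (ball_fun h z) = eval (pgen Q setT gball phiball (reim h)) re_expr z /\
  complex.Im (ball_fun h z) = eval (pgen Q setT gball phiball (reim h)) im_expr z.
Proof.
move=> [_ Oz]; rewrite /ball_fun Re_mulc Im_mulc ball_fun_cpow//=.
rewrite /fibre_map phiballE /reim mulN1r; split=> //.
Qed.

Lemma ball_fun_smooth Q h : quadrant_open Q -> csmooth_on (fdom Q [set: 'rV[R]_N]) h ->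
  csmooth_on (fdom Q (@oball R N)) (ball_fun h).
Proof.
move=> Qq hs.
have H f e : (forall z, fdom Q (@oball R N) z -> f z =
    eval (pgen Q setT gball phiball (reim h)) e z) -> smooth_on (fdom Q (@oball R N)) f.
  apply: (@smooth_on_pexpr _ _ _ _ _ Q (@oball R N) setT Qq (@oball_open R N) openT
    gball (drgen (complex.Re (- mu)) (complex.Im (- mu)) duball dvball dlamball) _ _ phiball _
    (reim h) (reim_smooth hs)).
  - by apply: rgen_cont; [exact: duballP|exact: dvballP|exact: dlamballP].
  - by apply: rgen_diffq; [exact: duballP|exact: dvballP|exact: dlamballP].
  - by [].
by split; [apply: (H _ re_expr)|apply: (H _ im_expr)] => z Dz; have [] := ball_fun_eval h Dz.
Qed.

(** Undoes [ball_fun]: [toball] is a right inverse of [unball], and the powers with exponents [mu]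
    and [- mu] cancel. *)
Lemma plane_fun_eval Q h z :
  complex.Re (h z) = eval (pgen Q (@oball R N) gplane phiplane (reim (ball_fun h))) re_expr z /\
  complex.Im (h z) = eval (pgen Q (@oball R N) gplane phiplane (reim (ball_fun h))) im_expr z.
Proof.
have -> : h z = cpow (bra (rsubmx z)) mu * ball_fun h (fibre_map gplane phiplane z).
  rewrite /ball_fun /fibre_map phiplaneE row_mxKl row_mxKr toballK hsubmxK mulrA cpowN ?mul1r//.
  exact: bra_gt0.
move: (ball_fun h) => g; rewrite Re_mulc Im_mulc cpowE ?bra_gt0//= mulN1r; split=> //.
Qed.

Lemma pders_plane Q h w : quadrant_open Q -> csmooth_on (fdom Q [set: 'rV[R]_N]) h ->
  forall z, fdom Q [set: 'rV[R]_N] z ->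
  cpders (fdom Q setT) w h z =
  Complex (eval (pgen Q (@oball R N) gplane phiplane (reim (ball_fun h)))
             (ders (dplane (complex.Re mu) (complex.Im mu)) w re_expr) z)
          (eval (pgen Q (@oball R N) gplane phiplane (reim (ball_fun h)))
             (ders (dplane (complex.Re mu) (complex.Im mu)) w im_expr) z).
Proof.
move=> Qq hs.
have H f e : (forall z, fdom Q setT z -> f z =
    eval (pgen Q (@oball R N) gplane phiplane (reim (ball_fun h))) e z) ->
    forall z, fdom Q setT z -> pders (fdom Q setT) w f z =
    eval (pgen Q (@oball R N) gplane phiplane (reim (ball_fun h)))
     (ders (dplane (complex.Re mu) (complex.Im mu)) w e) z.
  move=> fe z Dz.
  apply: (pders_pexpr (dfg := drgen (complex.Re mu) (complex.Im mu) duplane dvplane dlamplane)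
    Qq openT (@oball_open R N) _ _ (reim_smooth (ball_fun_smooth Qq hs)) w fe Dz).
    by apply: rgen_diffq => y _; [exact: duplaneP|exact: dvplaneP|exact: dlamplaneP].
  by move=> y _; rewrite phiplaneE; exact: sqn_toball_lt1.
move=> z Dz; rewrite /cpders; congr Complex; apply: H => // y _.
  by have [] := plane_fun_eval Q h y.
by have [] := plane_fun_eval Q h y.
Qed.

(** The two parts of [h] are expressions of order [complex.Re mu] that are linear in the parts of
    [ball_fun h]; each fibre derivative lowers the order by one. The constant and the words precede
    [Q] and [h], so one choice serves all charts and symbols. *)
Lemma ball_to_plane_estimate (al : seq 'I_n) (be : seq 'I_N) :
  exists (c : R) (F : seq (seq 'I_(n + N))), [/\ 0 <= c, (forall w, w \in F -> mixed_words w) &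
    forall Q h dl, quadrant_open Q -> csmooth_on (fdom Q [set: 'rV[R]_N]) h -> 0 <= dl ->
      (forall w z, w \in F -> fdom Q (@oball R N) z ->
         cabs (cpders (fdom Q (@oball R N)) w (ball_fun h) z) <= dl) ->
      forall z, fdom Q [set: 'rV[R]_N] z ->
      cabs (cpders (fdom Q [set: 'rV[R]_N]) (xword al ++ fword be) h z) <=
        c * dl * bra (rsubmx z) `^ (complex.Re mu - (size be)%:R)].
Proof.
have Wnil : base_words ([::] : seq 'I_(n + N)) by exists [::].
have Hre : ord (complex.Re mu) base_words true (complex.Re mu) re_expr.
  apply: ordA.
    by apply: ord_eq; [apply: ordMr; constructor|rewrite addr0].
  by apply: ord_eq; [apply: ordMr; [constructor|apply: ordMr; constructor]|rewrite add0r addr0].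
have Him : ord (complex.Re mu) base_words true (complex.Re mu) im_expr.
  apply: ordA.
    by apply: ord_eq; [apply: ordMr; constructor|rewrite addr0].
  by apply: ord_eq; [apply: ordMr; constructor|rewrite addr0].
have [c [F [c0 FW H]]] := ord_bound (complex.Im mu) (ord_ders (complex.Im mu) al be Hre).
have [c' [F' [c'0 F'W H']]] := ord_bound (complex.Im mu) (ord_ders (complex.Im mu) al be Him).
exists (c + c'), (F ++ F'); split; first exact: addr_ge0.
  by move=> w; rewrite mem_cat => /orP[/FW|/F'W].
move=> Q h dl Qq hs dl0 HB z Dz.
have D2 : fdom Q (@oball R N) (fibre_map gplane phiplane z).
  split; rewrite /fibre_map ?row_mxKl; first by case: Dz.
  by rewrite row_mxKr phiplaneE; exact: sqn_toball_lt1.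
have HB' i w : w \in F ++ F' -> `|pders (fdom Q (@oball R N)) w (reim (ball_fun h) i)
    (fibre_map gplane phiplane z)| <= dl.
  move=> wF; apply: le_trans (HB w _ wF D2).
  by case: i; [exact: (Re_le_cabs (cpders _ w (ball_fun h) _))
    |exact: (Im_le_cabs (cpders _ w (ball_fun h) _))].
rewrite pders_plane//; apply: le_trans (cabs_le _) _; rewrite /= !mulrDl.
apply: lerD.
  by apply: (H Q _ dl) => // i w wF; apply: HB'; rewrite mem_cat wF.
by apply: (H' Q _ dl) => // i w wF; apply: HB'; rewrite mem_cat wF orbT.
Qed.

End flat_estimate.

(** * Symbols on the bundle *)

(** Needed because [ball_rep] and [ball_fun] are only known to agree over the image of the chart. *)
Lemma pders_eq_on (R : realType) d (D : set 'rV[R]_d) (f g : 'rV[R]_d -> R) w z :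
  proper_increments D -> smooth_on D g -> (forall y, D y -> f y = g y) -> D z ->
  pders D w f z = pders D w g z.
Proof.
move=> hD gs fg Dz.
rewrite (@pders_wexpr _ _ _ _ (fun _ : unit => g) hD (fun=> gs) f (Gen (tt, [::])) w fg z Dz).
have -> : ders (@dwgen R d unit) w (Gen (tt, [::])) = Gen (tt, w) by elim: w => //= k w ->.
by [].
Qed.

Section symbols.
Context {R : realType} {n N : nat} {B : obundle R n N} (K : symbol_cover B).
Local Notation symbol := (vtotal B -> R[i]).
Implicit Types a b : symbol.

Lemma cov_ok i : chart_ok (@vip _ _ _ B) (cov (s := K) i).
Proof. exact: atlas_ok (cov_atlas i). Qed.

Lemma symbol_dom (c : bchart n N (@fib R n N B)) :
  [set z : 'rV[R]_(n + N) | cimg c (lsubmx z)] = fdom (cimg c) [set: 'rV[R]_N].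
Proof. by apply/seteqP; split => z //= []. Qed.

Definition loc i a := local_rep (cov (s := K) i) (localize i a).

Lemma loc_smooth i a : smooth_symbol a ->
  csmooth_on (fdom (cimg (cov i)) [set: 'rV[R]_N]) (loc i a).
Proof.
move=> as_; have [ar ai] := as_ _ (cov_atlas i); rewrite symbol_dom in ar ai.
have Qq := chart_img (cov_ok i).
have cs := smooth_on_lsubmx Qq (@openT 'rV[R]_N) (@chi_smooth _ _ _ _ K i _ (cov_atlas i)).
split.
- have -> : (fun z => complex.Re (loc i a z)) =
    (fun z => (chi i \o cinv (cov i)) (lsubmx z) * complex.Re (local_rep (cov i) a z)).
    by apply/funext => z; rewrite /loc /local_rep /localize Re_mulc /= mul0r subr0.
  by apply: smooth_onM => //; exact: fdom_proper openT.
- have -> : (fun z => complex.Im (loc i a z)) =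
    (fun z => (chi i \o cinv (cov i)) (lsubmx z) * complex.Im (local_rep (cov i) a z)).
    by apply/funext => z; rewrite /loc /local_rep /localize Im_mulc /= mul0r addr0.
  by apply: smooth_onM => //; exact: fdom_proper openT.
Qed.

(** One real-linear form that covers sums with real coefficients ([lin]), the conjugate ([sconj]),
    and the real and imaginary parts needed for the adjoint of q. *)
Definition comb (p q r s : R) a b : symbol := fun v =>
  Complex (p * complex.Re (a v) + (q * complex.Im (a v) + complex.Re (b v)))
          (r * complex.Re (a v) + (s * complex.Im (a v) + complex.Im (b v))).

Lemma comb_smooth p q r s a b : smooth_symbol a -> smooth_symbol b ->
  smooth_symbol (comb p q r s a b).
Proof.
move=> as_ bs c cA; have [ar ai] := as_ c cA; have [br bi] := bs c cA.
have hD : proper_increments [set z : 'rV[R]_(n + N) | cimg c (lsubmx z)].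
  rewrite symbol_dom; apply: fdom_proper openT; exact: chart_img (atlas_ok cA).
by split; rewrite /local_rep /comb /=; do 2 apply: smooth_on_lin => //.
Qed.

Lemma symbol_quotE m al be a i z : symbol_quot m al be a i z =
  cabs (cpders (fdom (cimg (cov (s := K) i)) [set: 'rV[R]_N]) (xword al ++ fword be) (loc i a) z)
  / bra (rsubmx z) `^ (m - (size be)%:R).
Proof. by rewrite /symbol_quot symbol_dom. Qed.

Lemma symbol_quot_comb p q r s m al be a b i z : smooth_symbol a -> smooth_symbol b ->
  cimg (cov i) (lsubmx z) ->
  symbol_quot m al be (comb p q r s a b) i z <=
  (`|p| + `|q| + `|r| + `|s|) * symbol_quot (K := K) m al be a i z
  + 2 * symbol_quot m al be b i z.
Proof.
move=> as_ bs Qz; rewrite !symbol_quotE !mulrA -mulrDl.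
apply: ler_wpM2r; first by rewrite invr_ge0 powR_ge0.
have [ar ai] := loc_smooth i as_; have [br bi] := loc_smooth i bs.
have hD := fdom_proper (chart_img (cov_ok i)) (@openT 'rV[R]_N).
set D := fdom _ _ in ar ai br bi hD *; set w := _ ++ _.
have Dz : D z by [].
have E : cpders D w (loc i (comb p q r s a b)) z =
  Complex (p * complex.Re (cpders D w (loc i a) z) + (q * complex.Im (cpders D w (loc i a) z)
             + complex.Re (cpders D w (loc i b) z)))
          (r * complex.Re (cpders D w (loc i a) z) + (s * complex.Im (cpders D w (loc i a) z)
             + complex.Im (cpders D w (loc i b) z))).
  rewrite /cpders /=; congr Complex.
    rewrite -(pders_lin hD q w ai br Dz) -(pders_lin hD p w ar (smooth_on_lin hD q ai br) Dz).
    congr (pders D w _ z); apply/funext => y.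
    rewrite /loc /local_rep /localize /comb !Re_mulc !Im_mulc /=.
    by ring.
  rewrite -(pders_lin hD s w ai bi Dz) -(pders_lin hD r w ar (smooth_on_lin hD s ai bi) Dz).
  congr (pders D w _ z); apply/funext => y.
    rewrite /loc /local_rep /localize /comb !Re_mulc !Im_mulc /=.
  by ring.
(* The modulus is estimated by the sum of the absolute values of both parts; each contributes one
   modulus of the [b] term, hence the factor 2 in the statement. *)
rewrite E; apply: le_trans (cabs_le _) _ => /=.
set A := cpders D w (loc i a) z; set A' := cpders D w (loc i b) z.
have T (x y : R) : `|x * complex.Re A + (y * complex.Im A + complex.Re A')| <=
    (`|x| + `|y|) * cabs A + cabs A'.
  apply: le_trans (ler_normD _ _) _; rewrite mulrDl -addrA; apply: lerD.
    by rewrite normrM; apply: ler_wpM2l => //; exact: Re_le_cabs.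
  apply: le_trans (ler_normD _ _) _; apply: lerD; last exact: Re_le_cabs.
  by rewrite normrM; apply: ler_wpM2l => //; exact: Im_le_cabs.
have T' (x y : R) : `|x * complex.Re A + (y * complex.Im A + complex.Im A')| <=
    (`|x| + `|y|) * cabs A + cabs A'.
  apply: le_trans (ler_normD _ _) _; rewrite mulrDl -addrA; apply: lerD.
    by rewrite normrM; apply: ler_wpM2l => //; exact: Re_le_cabs.
  apply: le_trans (ler_normD _ _) _; apply: lerD; last exact: Im_le_cabs.
  by rewrite normrM; apply: ler_wpM2l => //; exact: Im_le_cabs.
apply: le_trans (lerD (T p q) (T' r s)) _.
by rewrite le_eqVlt; apply/orP; left; apply/eqP; ring.
Qed.

Lemma S10_comb p q r s m a b : S10 K m a -> S10 K m b -> S10 K m (comb p q r s a b).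
Proof.
move=> [as_ ab] [bs bb]; split; first exact: comb_smooth.
move=> al be; have [c1 H1] := ab al be; have [c2 H2] := bb al be.
exists ((`|p| + `|q| + `|r| + `|s|) * c1 + 2 * c2) => i z Qz.
apply: le_trans (symbol_quot_comb _ _ _ _ _ _ _ as_ bs Qz) _; apply: lerD.
  by apply: ler_wpM2l; [rewrite !addr_ge0|exact: H1].
by apply: ler_wpM2l => //; exact: H2.
Qed.

Definition lin (t : R) a b : symbol := fun v => t%:C%C * a v + b v.

Lemma lin_comb t a b : lin t a b = comb t 0 0 t a b.
Proof.
apply/funext => v; rewrite /lin /comb; case: (a v) (b v) => x y [x' y'].
by congr Complex => /=; ring.
Qed.

Lemma S10_lin t m a b : S10 K m a -> S10 K m b -> S10 K m (lin t a b).
Proof. by rewrite lin_comb; exact: S10_comb. Qed.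

Lemma homogeneous_lin t mu a b : homogeneous mu a -> homogeneous mu b ->
  homogeneous mu (lin t a b).
Proof.
move=> [r r0 Ha] [r' r'0 Hb]; exists (Num.max r r') => [|s v s0].
  by rewrite lt_max r0.
rewrite !ge_max => /andP[v1 v2] /andP[s1 s2].
by rewrite /lin Ha// Hb// mulrDr mulrCA.
Qed.

Lemma Scl_lin t mu a b : Scl K mu a -> Scl K mu b -> Scl K mu (lin t a b).
Proof.
move=> [Sa [a_ [Ha Ra]]] [Sb [b_ [Hb Rb]]]; split; first exact: S10_lin.
exists (fun j => lin t (a_ j) (b_ j)); split.
  move=> j; have [? ?] := Ha j; have [? ?] := Hb j.
  by split; [exact: S10_lin|exact: homogeneous_lin].
move=> k; have -> : lin t a b - \sum_(j < k) lin t (a_ j) (b_ j) =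
    lin t (a - \sum_(j < k) a_ j) (b - \sum_(j < k) b_ j).
  apply/funext => v; rewrite /lin !fctE !fct_sumE mulrBr mulr_sumr.
  rewrite big_split /=; ring.
exact: S10_lin.
Qed.

Lemma Scl_S10 mu a : Scl K mu a -> S10 K (complex.Re mu) a.
Proof. by case. Qed.

Lemma Scl_Sinf mu a : Scl K mu a -> Sinf K a.
Proof. by move=> [H _]; exists (complex.Re mu). Qed.

(** The second argument already contributes [a] once, so the coefficient -2 turns the imaginary part
    into its negative. *)
Definition sconj a : symbol := comb 0 0 0 (-2) a a.

Lemma sconjE a v : sconj a v = Complex (complex.Re (a v)) (- complex.Im (a v)).
Proof. by congr Complex; ring. Qed.

(** Trivializations are isometric, so the weight is the same function of the fibre coordinate in
    every chart. *)
Lemma jap_trivialization (c : bchart n N (@fib R n N B)) x (xi : 'rV[R]_N) :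
  atlas c -> cimg c x -> jap (existT _ (cinv c x) (cfib c (cinv c x) xi) : vtotal B) = bra xi.
Proof.
move=> cA [x0 Dx0 <-]; have ok := atlas_ok cA; rewrite (chart_cancel ok Dx0).
rewrite /jap /vnorm /bra /=; congr (Num.sqrt (1 + _)).
rewrite (chart_isom ok Dx0) (chart_fibK ok Dx0) -/(sqn xi) /sqn.
rewrite sqr_sqrtr; first by apply: eq_bigr => k _; rewrite expr2.
by apply: sumr_ge0 => k _; rewrite -?expr2 ?sqr_ge0.
Qed.

Lemma ball_repE mu i a z : cimg (cov i) (lsubmx z) ->
  ball_rep (K := K) mu i a z = ball_fun mu (loc i a) z.
Proof.
move=> Qz; rewrite /ball_rep /ball_fun /loc /local_rep /localize row_mxKl row_mxKr.
rewrite jap_trivialization//; [exact: mulrCA|exact: cov_atlas].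
Qed.

(** The chart estimate passes to the supremum over the cover because its constant is common to all
    charts. The auxiliary real [dl] avoids multiplying seminorms that may be infinite. *)
Lemma Scl_estimate mu al be : exists (c : R) (F : seq (seq 'I_n * seq 'I_N)), 0 <= c /\
  forall a dl, smooth_symbol a -> 0 <= dl ->
    (forall ab, ab \in F -> (Scl_norm K mu ab a <= dl%:E)%E) ->
    (S10_norm K (complex.Re mu) (al, be) a <= (c * dl)%:E)%E.
Proof.
have [c [F [c0 FW H]]] := ball_to_plane_estimate mu al be.
(* The words in [F] are of mixed form, so each is recovered from a pair that indexes a seminorm of
   [Scl_norm]. *)
have [F' HF'] : exists F' : seq (seq 'I_n * seq 'I_N),
    forall w, w \in F -> exists2 ab, ab \in F' & w = xword ab.1 ++ fword ab.2.
  elim: F FW {H} => [|w F IH] FW; first by exists [::].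
  have [|F' HF'] := IH; first by move=> w' w'F; apply: FW; rewrite inE w'F orbT.
  have [|al' [be' E]] := FW w; first exact: mem_head.
  exists ((al', be') :: F') => w'; rewrite inE => /orP[/eqP ->|/HF'[ab abF ->]].
    by exists (al', be'); rewrite ?mem_head.
  by exists ab => //; rewrite inE abF orbT.
exists c, F'; split=> // a dl as_ dl0 Ha.
apply: ge_ereal_sup => _ [i [z [Qz ->]]]; rewrite lee_fin symbol_quotE.
have Qq := chart_img (cov_ok i); have ls := loc_smooth i as_.
rewrite ler_pdivrMr ?powR_gt0 ?bra_gt0//; apply: H => // w y wF Dy.
have [[al' be'] abF ->] := HF' _ wF.
rewrite -lee_fin; apply: le_trans (Ha _ abF); apply: ereal_sup_ubound => /=.
exists i, y; have [Qy Oy] := Dy; split=> //; congr (_%:E); congr cabs.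
have hD := fdom_proper Qq (@oball_open R N).
have [gr gi] := ball_fun_smooth mu Qq ls.
rewrite /cpders; congr Complex.
  by apply/esym/pders_eq_on => // u [Qu Ou]; rewrite ball_repE.
by apply/esym/pders_eq_on => // u [Qu Ou]; rewrite ball_repE.
Qed.

End symbols.

(** * Continuity for seminorms and descent to quotients *)

Section seminormed_continuity.
Context {R : realType} {X Y : zmodType} {I J : eqType}.
Variables (S : set X) (p : I -> X -> \bar R) (S' : set Y) (p' : J -> Y -> \bar R).

(** A basic neighbourhood in the target involves finitely many seminorms, so one at a time suffices:
    the index lists are joined and the minimum of the radii is taken. *)
Lemma seminormed_continuous (f : seminormed S p -> seminormed S' p') :
  (forall j (e : R), 0 < e -> exists (F : seq I) (dl : R), 0 < dl /\
    forall x y, (forall i, i \in F -> (p i (sval y - sval x)%R < dl%:E)%E) ->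
      (p' j (sval (f y) - sval (f x))%R < e%:E)%E) -> continuous f.
Proof.
move=> H; apply/continuousP => A; rewrite -[open A]/(seminormed_open (p := p') A) => oA.
rewrite -[open _]/(seminormed_open (p := p) (f @^-1` A)) => x Ax.
have [F [e [e0 FA]]] := oA (f x) Ax.
suff [G [dl [dl0 HG]]] : exists (G : seq I) (dl : R), 0 < dl /\
    forall y, (forall i, i \in G -> (p i (sval y - sval x)%R < dl%:E)%E) ->
      forall j, j \in F -> (p' j (sval (f y) - sval (f x))%R < e%:E)%E.
  by exists G, dl; split=> // y /HG; exact: FA.
elim: F {FA} => [|j F [G [dl [dl0 HG]]]]; first by exists [::], 1.
have [G' [dl' [dl'0 HG']]] := H j e e0.
exists (G ++ G'), (Num.min dl dl'); split; first by rewrite lt_min dl0.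
move=> y Hy k; rewrite inE => /orP[/eqP ->|kF].
  apply: HG' => i iG; have := Hy i; rewrite mem_cat iG orbT => /(_ isT) /lt_le_trans.
  by apply; rewrite lee_fin ge_min lexx orbT.
apply: HG kF => i iG; have := Hy i; rewrite mem_cat iG => /(_ isT) /lt_le_trans.
by apply; rewrite lee_fin ge_min lexx.
Qed.

End seminormed_continuity.

Lemma seminormed_inj (R : realType) (X : zmodType) (I : eqType) (S : set X) (p : I -> X -> \bar R)
  (x y : seminormed S p) : sval x = sval y -> x = y.
Proof.
by case: x y => x Sx [y Sy] /= xy; subst y; rewrite (Prop_irrelevance Sx Sy).
Qed.

Lemma quot_image_inj (T : topologicalType) (Y : Type) (f : T -> Y) (x y : quot_image f) :
  sval x = sval y -> x = y.
Proof.
by case: x y => x Sx [y Sy] /= xy; subst y; rewrite (Prop_irrelevance Sx Sy).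
Qed.

Lemma to_image_surj (T : topologicalType) (Y : Type) (f : T -> Y) (x : quot_image f) :
  exists t, to_image f t = x.
Proof. by case: x => y [t ft]; exists t; apply: quot_image_inj. Qed.

Lemma continuous_pairing (A B C : topologicalType) (f : A -> B) (g : A -> C) :
  continuous f -> continuous g -> continuous (fun x => (f x, g x)).
Proof. by move=> fc gc x; apply: cvg_pair; [exact: fc|exact: gc]. Qed.

Lemma continuous_compose (A B C : topologicalType) (f : A -> B) (g : B -> C) :
  continuous f -> continuous g -> continuous (g \o f).
Proof. by move=> fc gc x; apply: continuous_comp; [exact: fc|exact: gc]. Qed.

Definition open_map (T Q : topologicalType) (pi : T -> Q) :=
  forall U, open U -> open (pi @` U).

(** A product of two quotient maps need not be a quotient map, whereas a product of open surjections
    is again open. This is why openness is required of each factor. *)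
Lemma restricts_continuous_descend (T1 T2 A B C : topologicalType) (X Y Z : Type)
    (pi1 : T1 -> A) (pi2 : T2 -> B) (iA : A -> X) (iB : B -> Y) (iC : C -> Z)
    (op : X -> Y -> Z) (G : T1 * T2 -> C) :
  open_map pi1 -> (forall x, exists t, pi1 t = x) ->
  open_map pi2 -> (forall x, exists t, pi2 t = x) ->
  injective iC -> continuous G ->
  (forall t1 t2, iC (G (t1, t2)) = op (iA (pi1 t1)) (iB (pi2 t2))) ->
  restricts_continuous iA iB iC op.
Proof.
move=> o1 s1 o2 s2 iCI Gc GP.
pose r1 x := projT1 (cid (s1 x)); pose r2 x := projT1 (cid (s2 x)).
have r1K x : pi1 (r1 x) = x by exact: projT2 (cid (s1 x)).
have r2K x : pi2 (r2 x) = x by exact: projT2 (cid (s2 x)).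
pose f (x : A * B) := G (r1 x.1, r2 x.2).
(* [f] is defined through chosen preimages; the choice is immaterial because [iC] is injective and
   [iC] of [G] depends on the images only. *)
have fP t1 t2 : f (pi1 t1, pi2 t2) = G (t1, t2).
  by apply: iCI; rewrite !GP r1K r2K.
exists f; first by move=> a b; rewrite -{1}(r1K a) -{1}(r2K b) fP GP r1K r2K.
move=> [a b] W; rewrite -(r1K a) -(r2K b) fP => /Gc [[U1 U2] /= [n1 n2] UW].
exists (pi1 @` U1°, pi2 @` U2°) => /=.
  split; apply: open_nbhs_nbhs; split.
  - by apply: o1; exact: open_interior.
  - by exists (r1 a).
  - by apply: o2; exact: open_interior.
  - by exists (r2 b).
move=> [x y] /= [[t1 /interior_subset Ut1 <-] [t2 /interior_subset Ut2 <-]].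
by rewrite fP; apply: (UW (t1, t2)).
Qed.

Lemma id_open_map (T : topologicalType) : open_map (@id T).
Proof. by move=> U; rewrite image_id. Qed.

Section symbol_maps.
Context {R : realType} {n N : nat} {B : obundle R n N} (K : symbol_cover B).

Definition Scl_incl mu (x : Scl_space K mu) : S10_space K (complex.Re mu) :=
  exist _ (sval x) (Scl_S10 (svalP x)).

Lemma Scl_incl_continuous mu : continuous (@Scl_incl mu).
Proof.
apply: seminormed_continuous => -[al be] e e0.
have [c [F [c0 H]]] := Scl_estimate K mu al be.
(* The denominator [c + 1] allows for [c = 0] and keeps [c * (e / (c + 1))] strictly below [e]. *)
have dl0 : 0 < e / (c + 1) by rewrite divr_gt0// ltr_wpDl.
exists F, (e / (c + 1)); split=> // x y Hxy.
have as_ : smooth_symbol (sval y - sval x).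
  have -> : sval y - sval x = lin (-1) (sval x) (sval y).
    by apply/funext => v; rewrite /lin !fctE rmorphN1 mulN1r addrC.
  have [sx _] := Scl_S10 (svalP x); have [sy _] := Scl_S10 (svalP y).
  by rewrite lin_comb; exact: comb_smooth.
apply: le_lt_trans (H _ _ as_ (ltW dl0) _) _.
  by move=> ab abF; apply/ltW/Hxy.
by rewrite lte_fin mulrCA gtr_pMr// ltr_pdivrMr ?ltr_wpDl// mul1r ltrDl.
Qed.

Definition S10_conj m (x : S10_space K m) : S10_space K m :=
  exist _ (sconj (sval x)) (S10_comb 0 0 0 (-2) (svalP x) (svalP x)).

Lemma S10_conj_continuous m : continuous (@S10_conj m).
Proof.
apply: seminormed_continuous => -[al be] e e0.
(* Conjugation, as a [comb], costs the factor 2 + 2 = 4. This leaves [e / 2], so the inequality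
   stays strict after the supremum is taken. *)
have dl0 : 0 < e / 8 by rewrite divr_gt0.
exists [:: (al, be)], (e / 8); split=> // x y Hxy.
have [sx _] := svalP x; have [sy _] := svalP y.
have as_ : smooth_symbol (sval y - sval x).
  have -> : sval y - sval x = lin (-1) (sval x) (sval y).
    by apply/funext => v; rewrite /lin !fctE rmorphN1 mulN1r addrC.
  by rewrite lin_comb; exact: comb_smooth.
have /= -> : sval (S10_conj y) - sval (S10_conj x) = sconj (sval y - sval x).
  apply/funext => v; rewrite /= !fctE !sconjE.
  by case: (sval y v) (sval x v) => ? ? [? ?] /=; congr Complex; rewrite opprD.
apply: (@le_lt_trans _ _ (e / 2)%:E); last first.
  by rewrite lte_fin ltr_pdivrMr// ltr_pMr// ltr1n.
apply: ge_ereal_sup => _ [i [z [Qz ->]]]; rewrite lee_fin.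
apply: le_trans (symbol_quot_comb _ _ _ _ _ _ _ as_ as_ Qz) _.
have : symbol_quot m al be (sval y - sval x) i z <= e / 8.
  rewrite -lee_fin; apply: le_trans (ltW (Hxy (al, be) _)); last exact: mem_head.
  by apply: ereal_sup_ubound; exists i, z.
move: (symbol_quot _ _ _ _ _ _) => s se.
rewrite !normr0 !add0r normrN ger0_norm//.
by lra.
Qed.

(** Translation by [b - a], with membership in the space of classical symbols built in. *)
Definition Scl_shift mu (a b : Scl_space K mu) (x : Scl_space K mu) : Scl_space K mu :=
  exist _ (lin 1 (sval x) (lin (-1) (sval a) (sval b)))
    (Scl_lin 1 (svalP x) (Scl_lin (-1) (svalP a) (svalP b))).

Lemma Scl_shift_continuous mu a b : continuous (@Scl_shift mu a b).
Proof.
apply: seminormed_continuous => ab e e0; exists [:: ab], e; split=> // x y H.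
have -> : sval (Scl_shift a b y) - sval (Scl_shift a b x) = sval y - sval x.
  apply/funext => v; rewrite /= /lin !fctE rmorph1 !mul1r.
  by rewrite opprD addrACA subrr addr0.
by apply: H; exact: mem_head.
Qed.

End symbol_maps.

(** * Operators *)

Section operators.
Context {R : realType} {H : hilbert R} (D : smoothing_data H).

Lemma opappE (A : Wop D) (u : {u : H | Wdom D u}) : opapp A (sval u) = A u.
Proof.
case: u => u hu; rewrite /opapp; case: pselect => //= h.
by rewrite (Prop_irrelevance h hu).
Qed.

Lemma Wdom_wop k (T : Wm D k) x : (0 < k)%N -> Wdom D (wop T x).
Proof. by move=> k0 L _ _ LW; exact: LW. Qed.

Lemma Wdom_lin (s : R[i]) x y : Wdom D x -> Wdom D y -> Wdom D (s *: x + y).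
Proof. by move=> Wx Wy L L0 LD LW; apply: (LD); [exact: Wx|exact: Wy]. Qed.

Lemma Wdom0 : Wdom D 0.
Proof. by move=> L. Qed.

Lemma hip_ext (x y : H) : (forall w, hip x w = hip y w) -> x = y.
Proof.
move=> xy; apply/eqP; rewrite -subr_eq0 -normr_eq0 -sqrf_eq0 hip_norm.
have {1}-> : x - y = (-1) *: y + x by rewrite scaleN1r addrC.
by rewrite hip_linear xy mulN1r addNr.
Qed.

Lemma hip_linear_r (s : R[i]) (u v w : H) :
  hip w (s *: u + v) = s^* * hip w u + hip w v.
Proof. by rewrite [LHS]hip_conj [hip w u]hip_conj [hip w v]hip_conj hip_linear rmorphD rmorphM. Qed.

End operators.

(** * Adjoints, module structures and the product of the algebra *)

Section weyl_algebra.
Context {R : realType} {n N : nat} {B : obundle R n N} (K : symbol_cover B).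
Context {H : hilbert R} (D : smoothing_data H).
Local Notation symbol := (vtotal B -> R[i]).
Variables (P : symbol -> symbol -> symbol) (q : symbol -> Wop D).
Hypothesis hW : extended_weyl K P q.

Lemma wop_lin k (T : Wm D k) (s : R[i]) u v : (0 < k)%N ->
  wop T (s *: u + v) = s *: wop T u + wop T v.
Proof. by move=> k0; have [L _] := ew_bounded hW T k0. Qed.

Lemma wopD k (S T : Wm D k) u : (0 < k)%N -> wop (S + T) u = wop S u + wop T u.
Proof. by move=> k0; rewrite -[S]scale1r (ew_linear hW)// !scale1r. Qed.

Lemma wopN k (T : Wm D k) u : (0 < k)%N -> wop (- T) u = - wop T u.
Proof.
move=> k0; apply/eqP; rewrite -addr_eq0 -wopD// addNr.
by have /eqP := wopD (0 : Wm D k) 0 u k0; rewrite addr0 -subr_eq0 opprD addNKr oppr_eq0.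
Qed.

Lemma opapp_q_dom a u : Sinf K a -> Wdom D u -> Wdom D (opapp (q a) u).
Proof.
move=> Sa Wu; suff [] : Wdom D u /\ Wdom D (opapp (q a) u) by [].
(* [Wdom] is a linear span, so its definition is an induction principle. The predicate also carries
   [Wdom D u], since [q a] is linear only on the domain. *)
apply: (Wu (fun u => Wdom D u /\ Wdom D (opapp (q a) u))).
- split; first exact: Wdom0.
  (* Linearity with the scalar -1 at two zero vectors shows that [q a] maps 0 to 0. *)
  have := ew_q_op hW Sa (-1) (@Wdom0 R H D) (@Wdom0 R H D).
  by rewrite scaler0 addr0 scaleN1r addNr => ->; exact: Wdom0.
- move=> s x y [Wx Wqx] [Wy Wqy]; split; first exact: Wdom_lin.
  by rewrite (ew_q_op hW)//; exact: Wdom_lin.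
- move=> k T x k0; split; first exact: Wdom_wop.
  have [m Sm] := Sa; have [T' E] := ew_module hW T Sm k0.
  by rewrite -E; exact: Wdom_wop.
Qed.

(* The range of the injective symmetric operator of axiom (ii) is dense. *)
Lemma wop_dom_inj k (S T : Wm D k) : (0 < k)%N ->
  on_dom (wop S) = on_dom (wop T) :> Wop D -> S = T.
Proof.
move=> k0 ST; apply: (ew_injective hW k0); apply/funext => u.
have [star [starP _ _]] := ew_star hW k0.
have [T0 [T0I T0sa]] := ew_R hW.
have E v : wop S (wop T0 v) = wop T (wop T0 v).
  have W0 : Wdom D (wop T0 v) by exact: Wdom_wop.
  exact: (congr1 (fun A : Wop D => A (exist _ _ W0)) ST).
(* [S] and [T] agree on the range of [T0]. Passing to adjoints gives T0 S^* = T0 T^*, and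
   injectivity of [T0] gives S^* = T^*. *)
apply: hip_ext => w; rewrite !starP; congr hip; apply: T0I.
by apply: hip_ext => v; rewrite !T0sa ![hip _ (wop T0 v)]hip_conj -!starP -?E.
Qed.

Lemma Wm_incl k l : (0 < k)%N -> (k <= l)%N -> exists j : Wm D k -> Wm D l,
  continuous j /\ forall T, wop (j T) = wop T.
Proof.
move=> k0 /subnKC <-; elim: (l - k)%N => [|d [j [jc jE]]].
  by rewrite addn0; exists id; split=> // x; exact: cvg_id.
have kd0 : (0 < k + d)%N by rewrite addn_gt0 k0.
have [i [iE _ iO]] := ew_strict hW kd0; rewrite addnS; exists (i \o j); split.
  apply: continuous_compose => //; apply/continuousP => U oU.
  by apply/iO; exists U.
by move=> T; rewrite /= iE jE.
Qed.

(** Axiom (iii) speaks of real symbols. Writing b = r + i s and its conjugate as r - i s extends the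
    symmetry, since the inner product is conjugate linear in the second variable. *)
Lemma q_sconj m b u v : S10 K m b -> Wdom D u -> Wdom D v ->
  hip (opapp (q (sconj b)) u) v = hip u (opapp (q b) v).
Proof.
move=> Sb Wu Wv.
(* [r] and [s] are the real and the imaginary part of [b]. *)
pose r := comb 0 0 0 (-1) b b; pose s := comb (-1) 1 0 (-1) b b.
have Sr : Sinf K r by exists m; exact: S10_comb.
have Ss : Sinf K s by exists m; exact: S10_comb.
have rE x : r x = Complex (complex.Re (b x)) 0 by congr Complex; ring.
have sE x : s x = Complex (complex.Im (b x)) 0 by congr Complex; ring.
pose I : R[i] := Complex 0 1.
have bE : b = I *: s + r.
  apply/funext => x; rewrite !fctE rE sE; case: (b x) => x1 x2.
  by congr Complex => /=; ring.
have cE : sconj b = (- I) *: s + r.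
  apply/funext => x; rewrite !fctE sconjE rE sE; case: (b x) => x1 x2.
  by congr Complex => /=; ring.
have sym a x y : Sinf K a -> (forall v, complex.Im (a v) = 0) -> Wdom D x -> Wdom D y ->
    hip (opapp (q a) x) y = hip x (opapp (q a) y).
  move=> Sa a0 Wx Wy.
  have := ew_q_sym hW Sa a0 (exist _ x Wx) (exist _ y Wy).
  by rewrite -(opappE (q a) (exist _ x Wx)) -(opappE (q a) (exist _ y Wy)).
have qE t x : Wdom D x -> opapp (q (t *: s + r)) x = t *: opapp (q s) x + opapp (q r) x.
  move=> Wx; have E A : opapp A x = A (exist _ x Wx) by exact: (opappE A (exist _ x Wx)).
  by rewrite !E (ew_q_linear hW).
rewrite cE [in RHS]bE !qE// hip_linear hip_linear_r !sym//.
- by congr (_ * _ + _); rewrite /I; apply/eqP; rewrite eq_complex /= oppr0 !eqxx.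
- by move=> x; rewrite rE.
- by move=> x; rewrite sE.
Qed.

(** The axioms let q act from the left only. Two adjoints turn this into an action from the right,
    at levels [k] and [k.+1], so the level still rises by only one. *)
Lemma left_module m k : (0 < k)%N -> exists G : S10_space K m * Wm D k -> Wm D k.+1,
  continuous G /\ forall b S u, Wdom D u -> wop (G (b, S)) u = wop S (opapp (q (sval b)) u).
Proof.
move=> k0; have [M ME Mc] := ew_module_cont hW m k0.
have [star [starP starc _]] := ew_star hW k0.
have [star' [starP' starc' _]] := ew_star hW (ltn0Sn k).
exists (fun x => star' (M (S10_conj x.1, star x.2))); split.
  apply: continuous_compose starc'; apply: (continuous_compose _ Mc).
  apply: continuous_pairing.
    by apply: (continuous_compose _ (@S10_conj_continuous _ _ _ _ K m)) => x; exact: cvg_fst.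
  by apply: continuous_compose starc => x; exact: cvg_snd.
move=> b S u Wu /=.
have Wqu : Wdom D (opapp (q (sval b)) u).
  by apply: opapp_q_dom => //; exists m; exact: svalP b.
(* S^* v lies in the domain for every [v] in the Hilbert space, so [q_sconj] applies to all test
   vectors. *)
apply: hip_ext => v.
rewrite hip_conj -starP' ME /=.
rewrite (q_sconj (svalP b))//; last exact: Wdom_wop.
by rewrite -hip_conj starP.
Qed.

Local Notation qT k mu := (fun aT : Scl_space K mu * Wm D k => q (sval aT.1) + on_dom (wop aT.2)).

Lemma q_shift mu (a b x : Scl_space K mu) :
  q (sval (Scl_shift a b x)) = q (sval x) + (q (sval b) - q (sval a)).
Proof.
have linE (t : R) (y z : symbol) : lin t y z = t%:C%C *: y + z by [].
have Sx := Scl_Sinf (svalP x); have Sa := Scl_Sinf (svalP a); have Sb := Scl_Sinf (svalP b).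
rewrite /= linE (ew_q_linear hW)//; last first.
  by exists (complex.Re mu); apply: S10_lin; apply: Scl_S10; exact: svalP.
rewrite linE (ew_q_linear hW)// rmorph1 scale1r rmorphN1 scaleN1r.
by rewrite [- _ + _]addrC.
Qed.

Lemma Wmu_open_map mu k : (0 < k)%N -> open_map (@to_image _ _ (qT k mu)).
Proof.
move=> k0 U oU; rewrite -[open _]/(open (to_image (qT k mu) @^-1` (to_image (qT k mu) @` U))).
rewrite openE => -[a' T'] /= [[a T] UaT /(congr1 sval) /= E].
(* Translation by the difference of two points of one fibre. It carries [(a', T')] to [(a, T)] and
   preserves the image of every point, so the preimage of [U] under [tau] is a neighbourhood inside
   the saturation of [U]. *)
pose tau (x : Scl_space K mu * Wm D k) := (Scl_shift a' a x.1, x.2 + (T - T')).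
have tauc : continuous tau.
  apply: continuous_pairing.
    by apply: (continuous_compose _ (Scl_shift_continuous (a := a') (b := a))) => x; exact: cvg_fst.
  have c2 : continuous (fun x : Scl_space K mu * Wm D k => (x.2, T - T')).
    by apply: continuous_pairing => x; [exact: cvg_snd|exact: cvg_cst].
  exact: (continuous_compose c2 (@add_continuous (Wm D k))).
have tau0 : tau (a', T') = (a, T).
  rewrite /tau /= subrKC; congr pair; apply: seminormed_inj; apply/funext => v.
  by rewrite /= /lin rmorph1 rmorphN1 mul1r mulN1r addNKr.
have : nbhs (a', T') (tau @^-1` U).
  by apply: tauc; rewrite tau0; exact: open_nbhs_nbhs.
apply: filterS => -[x X] /= Ux; exists (tau (x, X)) => //.
apply: quot_image_inj; rewrite /= -/(Scl_shift a' a x) q_shift.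
apply/funext => u; rewrite !fctE /on_dom !wopD//.
have /(congr1 (fun A : Wop D => A u)) := E; rewrite !fctE /on_dom => Eu.
by rewrite wopN// addrACA [X in _ + X = _]addrACA -opprD Eu subrr addr0.
Qed.

Lemma opappD (A A' : Wop D) u : opapp (A + A') u = opapp A u + opapp A' u.
Proof. by rewrite /opapp; case: pselect => // h; rewrite addr0. Qed.

Lemma opapp_on_dom (T : H -> H) u : Wdom D u -> opapp (on_dom T : Wop D) u = T u.
Proof. by move=> Wu; exact: (opappE (on_dom T) (exist _ u Wu)). Qed.

(** [opapp] takes a default value off the domain; invariance of the domain shows that [opcomp] is a
    genuine composition on these operators. *)
Lemma Wmu_preserves_dom mu k (A : Wmu_space K q mu k) : (0 < k)%N -> preserves_dom (sval A).
Proof.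
move=> k0 u; case: A => _ [[a T] /= <-]; rewrite fctE.
have := opapp_q_dom (Scl_Sinf (svalP a)) (svalP u); rewrite opappE => Wq.
rewrite -[q _ u]scale1r; apply: Wdom_lin => //; exact: Wdom_wop.
Qed.

(** (q(a) + S) T = q(a) T + S T, where q(a) T has level [l.+1], which is at most [k + l] since [k]
    is positive. *)
Lemma Wmu_mul_smoothing mu k l : (0 < k)%N -> (0 < l)%N ->
  restricts_continuous (sval : Wmu_space K q mu k -> Wop D)
    (fun T : Wm D l => on_dom (wop T)) (fun T : Wm D (k + l) => on_dom (wop T))
    (@opcomp R H D).
Proof.
move=> k0 l0; have kl0 : (0 < k + l)%N by rewrite addn_gt0 k0.
have [M ME Mc] := ew_module_cont hW (complex.Re mu) l0.
have [i [ic iE]] := @Wm_incl l.+1 (k + l) isT (leq_add k0 (leqnn l)).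
have [mul mulE mulc] := ew_mul hW k0 l0.
pose G (x : Scl_space K mu * Wm D k * Wm D l) : Wm D (k + l) :=
  i (M (Scl_incl x.1.1, x.2)) + mul (x.1.2, x.2).
have Gc : continuous G.
  apply: (continuous_compose _ (@add_continuous (Wm D (k + l)))
    (f := fun x : Scl_space K mu * Wm D k * Wm D l =>
      (i (M (Scl_incl x.1.1, x.2)), mul (x.1.2, x.2)))).
  have c1 : continuous (fun x : Scl_space K mu * Wm D k * Wm D l => x.1).
    by move=> x; exact: cvg_fst.
  have c2 : continuous (fun x : Scl_space K mu * Wm D k * Wm D l => x.2).
    by move=> x; exact: cvg_snd.
  have c11 : continuous (fun x : Scl_space K mu * Wm D k * Wm D l => x.1.1).
    by apply: (continuous_compose c1) => x; exact: cvg_fst.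
  have c12 : continuous (fun x : Scl_space K mu * Wm D k * Wm D l => x.1.2).
    by apply: (continuous_compose c1) => x; exact: cvg_snd.
  apply: continuous_pairing.
    apply: (continuous_compose _ ic); apply: (continuous_compose _ Mc).
    apply: continuous_pairing => //.
    exact: (continuous_compose c11 (@Scl_incl_continuous _ _ _ _ K mu)).
  by apply: (continuous_compose _ mulc); exact: continuous_pairing.
apply: (restricts_continuous_descend (@Wmu_open_map mu k k0) (@to_image_surj _ _ _)
  (@id_open_map _) _ _ Gc).
- by move=> x; exists x.
- by move=> S T; exact: wop_dom_inj.
move=> [a S] T; apply/funext => u.
have WT : Wdom D (wop T (sval u)) by exact: Wdom_wop.
rewrite /opcomp /on_dom /G /= wopD// iE ME mulE /=.
by rewrite opappD opapp_on_dom.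
Qed.

(** The term S q(b) has level [k.+1], at most [k + l] since [l] is positive. The operator identity
    is checked on the domain and determines the smoothing operator by [wop_dom_inj]. *)
Lemma smoothing_mul_Wmu mu k l : (0 < k)%N -> (0 < l)%N ->
  restricts_continuous (fun T : Wm D k => on_dom (wop T))
    (sval : Wmu_space K q mu l -> Wop D) (fun T : Wm D (k + l) => on_dom (wop T))
    (@opcomp R H D).
Proof.
move=> k0 l0; have kl0 : (0 < k + l)%N by rewrite addn_gt0 k0.
have [M [Mc ME]] := left_module (complex.Re mu) k0.
have kl : (k.+1 <= k + l)%N by rewrite -addn1 leq_add2l.
have [i [ic iE]] := @Wm_incl k.+1 (k + l) isT kl.
have [mul mulE mulc] := ew_mul hW k0 l0.
pose T2 := (Scl_space K mu * Wm D l)%type.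
pose G (x : Wm D k * T2) : Wm D (k + l) :=
  i (M (Scl_incl x.2.1, x.1)) + mul (x.1, x.2.2).
have Gc : continuous G.
  apply: (continuous_compose _ (@add_continuous (Wm D (k + l)))
    (f := fun x : Wm D k * T2 => (i (M (Scl_incl x.2.1, x.1)), mul (x.1, x.2.2)))).
  have c1 : continuous (fun x : Wm D k * T2 => x.1).
    by move=> x; exact: cvg_fst.
  have c2 : continuous (fun x : Wm D k * T2 => x.2).
    by move=> x; exact: cvg_snd.
  have c21 : continuous (fun x : Wm D k * T2 => x.2.1).
    by apply: (continuous_compose c2) => x; exact: cvg_fst.
  have c22 : continuous (fun x : Wm D k * T2 => x.2.2).
    by apply: (continuous_compose c2) => x; exact: cvg_snd.
  apply: continuous_pairing.
    apply: (continuous_compose _ ic); apply: (continuous_compose _ Mc).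
    apply: continuous_pairing => //.
    exact: (continuous_compose c21 (@Scl_incl_continuous _ _ _ _ K mu)).
  by apply: (continuous_compose _ mulc); exact: continuous_pairing.
apply: (restricts_continuous_descend (@id_open_map _) _
  (@Wmu_open_map mu l l0) (@to_image_surj _ _ _) _ Gc).
- by move=> x; exists x.
- by move=> S T; exact: wop_dom_inj.
move=> S [b T]; apply/funext => u.
have Wq : Wdom D (opapp (q (sval b)) (sval u)).
  exact: opapp_q_dom (Scl_Sinf (svalP b)) (svalP u).
have WT : Wdom D (wop T (sval u)) by exact: Wdom_wop.
rewrite /opcomp /on_dom /G /= wopD// iE ME ?mulE /=; last exact: svalP.
have WqT : Wdom D (opapp (q (sval b)) (sval u) + wop T (sval u)).
  by rewrite -[X in X + _]scale1r; exact: Wdom_lin.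
rewrite fctE -[q (sval b) u]opappE (opapp_on_dom _ WqT).
by rewrite -[X in wop S (X + _)]scale1r wop_lin// scale1r.
Qed.

Lemma Wmu_mul_Wnu mu nu k l : (0 < k)%N -> (0 < l)%N ->
  restricts_continuous (sval : Wmu_space K q mu k -> Wop D)
    (sval : Wmu_space K q nu l -> Wop D)
    (sval : Wmu_space K q (mu + nu) (k + l) -> Wop D) (@opcomp R H D).
Proof.
move=> k0 l0; have kl0 : (0 < k + l)%N by rewrite addn_gt0 k0.
have [Mr MrE Mrc] := ew_module_cont hW (complex.Re mu) l0.
have [Ml [Mlc MlE]] := left_module (complex.Re nu) k0.
have [Em EmE Emc] := ew_qP hW (complex.Re mu) (complex.Re nu).
have [Pm PmE Pmc] := ew_P_Scl hW mu nu.
have [mul mulE mulc] := ew_mul hW k0 l0.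
have kl : (k.+1 <= k + l)%N by rewrite -addn1 leq_add2l.
have [i1 [i1c i1E]] := @Wm_incl 1 (k + l) isT kl0.
have [i2 [i2c i2E]] := @Wm_incl l.+1 (k + l) isT (leq_add k0 (leqnn l)).
have [i3 [i3c i3E]] := @Wm_incl k.+1 (k + l) isT kl.
pose T1 := (Scl_space K mu * Wm D k)%type; pose T2 := (Scl_space K nu * Wm D l)%type.
(* [G1] to [G4] are the smoothing terms E(a,b), q(a) T, S q(b) and S T, of levels 1, [l.+1], [k.+1]
   and [k + l], all moved to level [k + l]. *)
pose G1 (x : T1 * T2) := i1 (Em (Scl_incl x.1.1, Scl_incl x.2.1)).
pose G2 (x : T1 * T2) := i2 (Mr (Scl_incl x.1.1, x.2.2)).
pose G3 (x : T1 * T2) := i3 (Ml (Scl_incl x.2.1, x.1.2)).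
pose G4 (x : T1 * T2) := mul (x.1.2, x.2.2).
have c1 : continuous (fun x : T1 * T2 => x.1) by move=> x; exact: cvg_fst.
have c2 : continuous (fun x : T1 * T2 => x.2) by move=> x; exact: cvg_snd.
have c11 : continuous (fun x : T1 * T2 => x.1.1).
  by apply: (continuous_compose c1) => x; exact: cvg_fst.
have c12 : continuous (fun x : T1 * T2 => x.1.2).
  by apply: (continuous_compose c1) => x; exact: cvg_snd.
have c21 : continuous (fun x : T1 * T2 => x.2.1).
  by apply: (continuous_compose c2) => x; exact: cvg_fst.
have c22 : continuous (fun x : T1 * T2 => x.2.2).
  by apply: (continuous_compose c2) => x; exact: cvg_snd.
have ca : continuous (fun x : T1 * T2 => Scl_incl x.1.1).
  exact: (continuous_compose c11 (@Scl_incl_continuous _ _ _ _ K mu)).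
have cb : continuous (fun x : T1 * T2 => Scl_incl x.2.1).
  exact: (continuous_compose c21 (@Scl_incl_continuous _ _ _ _ K nu)).
have G1c : continuous G1.
  apply: (continuous_compose _ i1c); apply: (continuous_compose _ Emc).
  exact: continuous_pairing.
have G2c : continuous G2.
  apply: (continuous_compose _ i2c); apply: (continuous_compose _ Mrc).
  exact: continuous_pairing.
have G3c : continuous G3.
  apply: (continuous_compose _ i3c); apply: (continuous_compose _ Mlc).
  exact: continuous_pairing.
have G4c : continuous G4.
  by apply: (continuous_compose _ mulc); exact: continuous_pairing.
have cD (f g : T1 * T2 -> Wm D (k + l)) : continuous f -> continuous g ->
    continuous (fun x => f x + g x).
  move=> fc gc.
  exact: (continuous_compose (continuous_pairing fc gc) (@add_continuous (Wm D (k + l)))).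
pose G (x : T1 * T2) : Wmu_space K q (mu + nu) (k + l) :=
  to_image (qT (k + l) (mu + nu)) (Pm (x.1.1, x.2.1), ((G1 x + G2 x) + (G3 x + G4 x))).
have Gc : continuous G.
  have tc : continuous (@to_image _ _ (qT (k + l) (mu + nu))).
    by apply/continuousP => A oA; exact: oA.
  apply: (continuous_compose _ tc); apply: continuous_pairing.
    by apply: (continuous_compose _ Pmc); exact: continuous_pairing.
  by apply: (cD); exact: (cD).
apply: (restricts_continuous_descend (@Wmu_open_map mu k k0) (@to_image_surj _ _ _)
  (@Wmu_open_map nu l l0) (@to_image_surj _ _ _) _ Gc).
  exact: quot_image_inj.
move=> [a S] [b T]; apply/funext => u.
have Sa := Scl_Sinf (svalP a); have Sb := Scl_Sinf (svalP b).
have Wq : Wdom D (opapp (q (sval b)) (sval u)) by exact: opapp_q_dom Sb (svalP u).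
have WT : Wdom D (wop T (sval u)) by exact: Wdom_wop.
have WqT : Wdom D (opapp (q (sval b)) (sval u) + wop T (sval u)).
  by rewrite -[X in X + _]scale1r; exact: Wdom_lin.
(* The term q(P(a,b)) subtracted here cancels against the symbol part of [G] in the final
   identity. *)
have E1 : wop (G1 ((a, S), (b, T))) (sval u) =
    opapp (q (sval a)) (opapp (q (sval b)) (sval u)) - q (P (sval a) (sval b)) u.
  rewrite /G1 i1E /=; have /(congr1 (fun A : Wop D => A u)) := EmE (Scl_incl a) (Scl_incl b).
  by rewrite /on_dom /= => ->; rewrite fctE /opcomp opappE.
rewrite /= !fctE /on_dom !wopD// E1 /G2 /G3 /G4 i2E i3E MrE MlE ?mulE /=; last exact: svalP.
rewrite PmE /opcomp opappD -[q (sval b) u]opappE.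
rewrite (opapp_on_dom _ WqT).
have -> : opapp (q (sval a)) (opapp (q (sval b)) (sval u) + wop T (sval u)) =
    opapp (q (sval a)) (opapp (q (sval b)) (sval u)) + opapp (q (sval a)) (wop T (sval u)).
  by rewrite -[X in opapp _ (X + _)]scale1r (ew_q_op hW)// scale1r.
have -> : wop S (opapp (q (sval b)) (sval u) + wop T (sval u)) =
    wop S (opapp (q (sval b)) (sval u)) + wop S (wop T (sval u)).
  by rewrite -[X in wop S (X + _)]scale1r wop_lin// scale1r.
by rewrite addrA; congr (_ + _); rewrite addrA subrKC.
Qed.

End weyl_algebra.

Theorem proposition5p1 (R : realType) (n N : nat) (B : obundle R n N)
    (nabla : orth_connection B) (K : symbol_cover B) (hK : admissible K)
    (H : hilbert R) (D : smoothing_data H)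
    (P : (vtotal B -> R[i]) -> (vtotal B -> R[i]) -> (vtotal B -> R[i]))
    (q : (vtotal B -> R[i]) -> Wop D)
    (hW : extended_weyl K P q) (hsigma : condition_sigma K q)
    (mu nu : R[i]) (k l : nat) (hk : (0 < k)%N) (hl : (0 < l)%N) :
  [/\ (forall A : Wmu_space K q mu k, preserves_dom (sval A)) /\
      (forall A : Wmu_space K q nu l, preserves_dom (sval A)),
      restricts_continuous
        (sval : Scl_space K mu -> vtotal B -> R[i])
        (sval : Scl_space K nu -> vtotal B -> R[i])
        (sval : Scl_space K (mu + nu) -> vtotal B -> R[i]) P,
      restricts_continuous
        (sval : Wmu_space K q mu k -> Wop D)
        (fun T : Wm D l => on_dom (wop T))
        (fun T : Wm D (k + l) => on_dom (wop T)) (@opcomp R H D),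
      restricts_continuous
        (fun T : Wm D k => on_dom (wop T))
        (sval : Wmu_space K q mu l -> Wop D)
        (fun T : Wm D (k + l) => on_dom (wop T)) (@opcomp R H D) &
      restricts_continuous
        (sval : Wmu_space K q mu k -> Wop D)
        (sval : Wmu_space K q nu l -> Wop D)
        (sval : Wmu_space K q (mu + nu) (k + l) -> Wop D) (@opcomp R H D)].
Proof.
split.
- by split=> A; apply: (Wmu_preserves_dom hW).
- exact: (ew_P_Scl hW).
- exact: (Wmu_mul_smoothing hW).
- exact: (smoothing_mul_Wmu hW).
- exact: (Wmu_mul_Wnu hW).
Qed.
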